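(* For every integer $k\geq 2$ and every $\varepsilon>0$, there exists an integer $\ell_0\geq 1$ such that $\delta^*_{C_\ell^{k}}\leq \frac12+\varepsilon$ for all integers $\ell\geq \ell_0$, where $C_\ell^k$ is the $k$-uniform tight cycle of length $\ell$ and $\delta^*_{C_\ell^k}$ is its fractional decomposition threshold.
   Context: A $k$-graph (or $k$-uniform hypergraph) $H$ has a finite vertex set $V(H)$ and a set $E(H)$ of edges, each being a $k$-element subset of $V(H)$. For a $(k-1)$-set $x\subseteq V(H)$, the degree $d(x)$ is the number of edges of $H$ containing $x$, and $\delta(H):=\min\{d(x): x\in\binom{V(H)}{k-1}\}$ is the minimum degree of $H$. The (tight) cycle $C_\ell^k$ of length $\ell$ is the $k$-graph on $\ell$ vertices whose vertex set can be cyclically ordered such that a $k$-set forms an edge if and only if its elements appear consecutively in this cyclic ordering. For $k$-graphs $F$ and $H$, let $\mathcal{F}(H)$ be the set of all copies of $F$ in $H$ (that is, subgraphs of $H$ isomorphic to $F$). A fractional $F$-decomposition of $H$ is a function $\omega\colon\mathcal{F}(H)\to[0,1]$ with $\sum_{F'\in\mathcal{F}(H)\colon e\in E(F')}\omega(F')=1$ for all $e\in E(H)$. The fractional $F$-decomposition threshold $\delta_F^*$ is the least number $\delta$ such that for every $\mu>0$ there exists an integer $n_0$ such that every $k$-graph $H$ on $n\geq n_0$ vertices with $\delta(H)\geq(\delta+\mu)n$ admits a fractional $F$-decomposition. *)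

(* Defs.v *)
From HB Require Import structures.
From mathcomp Require Import classical_sets reals.
From mathcomp Require Import all_boot all_order all_algebra.

Set Implicit Arguments.
Unset Strict Implicit.
Unset Printing Implicit Defensive.

Import Order.TTheory GRing.Theory Num.Theory.

Local Open Scope ring_scope.

Record kgraph (k : nat) (V : finType) := KGraph {
  edges : {set {set V}};
  edges_uniform : forall e : {set V}, e \in edges -> #|e| = k }.

Definition degree (k : nat) (V : finType) (H : kgraph k V) (x : {set V}) : nat :=
  #|[set e in edges H | x \subset e]|.

(* The default value #|edges H| bounds every degree, so it does not affect the
   minimum as soon as V has a (k-1)-element subset. *)
Definition min_degree (k : nat) (V : finType) (H : kgraph k V) : nat :=
  \big[Order.min/#|edges H|]_(x : {set V} | #|x| == k.-1) degree H x.

(* ordS is the cyclic successor on 'I_l. *)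
Definition cyclic_segment (k l : nat) (i : 'I_l) : {set 'I_l} :=
  [set iter j (@ordS l) i | j : 'I_k]%SET.

(* The condition #|e| = k discards the segments that wrap around when l < k. *)
Definition tight_cycle_edges (k l : nat) : {set {set 'I_l}} :=
  [set e : {set 'I_l} |
    (#|e| == k) && [exists i : 'I_l, e == cyclic_segment k i]]%SET.

Lemma tight_cycle_uniform (k l : nat) (e : {set 'I_l}) :
  e \in tight_cycle_edges k l -> #|e| = k.
Proof. by rewrite inE => /andP[/eqP]. Qed.

Definition tight_cycle (k l : nat) : kgraph k 'I_l :=
  KGraph (@tight_cycle_uniform k l).

(* A pair (W, D) stands for the hypergraph with vertex set W and edge set D. *)
Definition is_subgraph (k : nat) (V : finType) (H : kgraph k V)
    (S : {set V} * {set {set V}}) : bool :=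
  (S.2 \subset edges H) && [forall e in S.2, e \subset S.1].

Definition is_isomorphic (k : nat) (U V : finType) (F : kgraph k U)
    (S : {set V} * {set {set V}}) : bool :=
  [exists f : {ffun U -> V},
    [&& injectiveb f,
        S.1 == (f @: [set: U])%SET &
        S.2 == [set f @: (e : {set U}) | e in edges F]%SET]].

Definition copies (k : nat) (U V : finType) (F : kgraph k U) (H : kgraph k V) :
    {set {set V} * {set {set V}}} :=
  [set S | is_subgraph H S && is_isomorphic F S]%SET.

(* Only the values of w on copies F H are relevant. *)
Definition fractional_decomposition (R : realType) (k : nat) (U V : finType)
    (F : kgraph k U) (H : kgraph k V)
    (w : {set V} * {set {set V}} -> R) : Prop :=
  (forall S, S \in copies F H -> 0 <= w S <= 1) /\
  (forall e, e \in edges H -> \sum_(S in copies F H | e \in S.2) w S = 1).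

Definition suffices_for_decomposition (R : realType) (k : nat) (U : finType)
    (F : kgraph k U) (delta : R) : Prop :=
  forall mu : R, 0 < mu ->
  exists n0 : nat, forall (V : finType) (H : kgraph k V),
    (n0 <= #|V|)%N ->
    (delta + mu) * #|V|%:R <= (min_degree H)%:R ->
    exists w : {set V} * {set {set V}} -> R, fractional_decomposition F H w.

(* inf is 0 on sets without an infimum; for k > 0 and F with at least two edges
   (such as tight_cycle k l with l > k) the infimum exists and is attained, by
   the lemmas at the end of this file. *)
Definition fractional_threshold (R : realType) (k : nat) (U : finType)
    (F : kgraph k U) : R :=
  inf [set delta : R | suffices_for_decomposition F delta]%classic.

Lemma min_degree_le_card (k : nat) (V : finType) (H : kgraph k V) :
  (0 < k <= #|V|)%N -> (min_degree H <= #|V|)%N.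
Proof.
move=> /andP[k0 kV].
have [x xk] : exists x : {set V}, #|x| = k.-1.
  have := kV; rewrite -cardsT => kT.
  have : (0 < #|[set A : {set V} | #|A| == k.-1]|)%N.
    by rewrite card_draws bin_gt0 (leq_trans (leq_pred k)).
  by case/card_gt0P => A; rewrite inE => /eqP; exists A.
have : (min_degree H <= degree H x)%N.
  by rewrite -leEnat; apply: bigmin_le_cond; rewrite xk.
move/leq_trans; apply.
have sub : [set e in edges H | x \subset e]%SET \subset [set v |: x | v : V]%SET.
  apply/subsetP => e; rewrite inE => /andP[eH xe].
  have ek := edges_uniform eH.
  have : #|e :\: x| = 1%N.
    have := cardsID x e; rewrite (setIidPr xe) xk ek.
    by rewrite -(prednK k0) /= -addn1 => /addnI.
  move/eqP/cards1P => [v hv]; apply/imsetP; exists v => //.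
  by rewrite -hv setUC -[LHS](setID e x) (setIidPr xe).
exact: leq_trans (subset_leq_card sub) (leq_imset_card _ _).
Qed.

Lemma suffices_for_decomposition1 (R : realType) (k : nat) (U : finType)
    (F : kgraph k U) :
  (0 < k)%N -> suffices_for_decomposition F (1 : R).
Proof.
move=> k0 mu mu0; exists k => V H kV.
have : ((min_degree H)%:R <= #|V|%:R :> R).
  by rewrite ler_nat min_degree_le_card // k0 kV.
move=> h1 h2; have := le_trans h2 h1.
rewrite mulrDl mul1r gerDl pmulr_rle0 // lern0 => /eqP V0.
by move: kV; rewrite V0 leqNgt k0.
Qed.

Lemma suffices_for_decomposition_ge0 (R : realType) (k : nat) (U : finType)
    (F : kgraph k U) (delta : R) :
  (1 < #|edges F|)%N -> suffices_for_decomposition F delta -> 0 <= delta.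
Proof.
move=> F1 hd; rewrite leNgt; apply/negP => d0.
have mu0 : 0 < - delta by rewrite oppr_gt0.
have [n0 hn0] := hd _ mu0.
pose V : finType := 'I_(n0 + k).
pose e : {set V} := [set i : V | (i < k)%N]%SET.
have ek : #|e| = k.
  have -> : e = [set widen_ord (leq_addl n0 k) i | i : 'I_k]%SET.
    apply/setP => i; rewrite inE; apply/idP/imsetP => [ik|[j _ ->]].
      by exists (Ordinal ik) => //; apply: val_inj.
    by rewrite /= ltn_ord.
  by rewrite card_imset ?card_ord // => i j /(congr1 val) /= /val_inj.
have eu : forall e' : {set V}, e' \in [set e]%SET -> #|e'| = k.
  by move=> e' /set1P ->.
pose H := KGraph eu.
have [||w [_ /(_ e)]] := hn0 V H.
- by rewrite card_ord leq_addr.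
- by rewrite subrr mul0r ler0n.
rewrite big_pred0 => [|S]; first by rewrite inE eqxx => /(_ isT) /esym/eqP; rewrite oner_eq0.
rewrite inE; apply/negbTE; apply/negP => /andP[/andP[/andP[sS _] /existsP[f hf]] _].
case/and3P: hf => /injectiveP finj _ /eqP S2.
have := subset_leq_card sS; rewrite S2 card_imset; last exact: imset_inj.
by rewrite cards1 leqNgt F1.
Qed.

Lemma card_tight_cycle_edges_gt1 (k l : nat) :
  (0 < k < l)%N -> (1 < #|edges (tight_cycle k l)|)%N.
Proof.
case: l => [|l]; first by rewrite andbF.
move=> /andP[k0 kl].
have iterE j (i : 'I_l.+1) : (iter j (@ordS l.+1) i : nat) = ((i + j) %% l.+1)%N.
  elim: j => [|j IH]; first by rewrite addn0 modn_small.
  by rewrite iterS /= IH -addn1 modnDml addn1 addnS.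
have segk (i : 'I_l.+1) : cyclic_segment k i \in tight_cycle_edges k l.+1.
  rewrite inE; apply/andP; split; last by apply/existsP; exists i.
  rewrite card_imset ?card_ord // => a b /(congr1 val); rewrite /= !iterE.
  move=> /eqP; rewrite eqn_modDl !modn_small => [/eqP/val_inj //| |];
    exact: leq_trans (ltn_ord _) (ltnW kl).
have l0 : (0 < l)%N by case: l kl {iterE segk} => //; rewrite ltnS leqNgt k0.
pose i0 : 'I_l.+1 := ord0; pose i1 : 'I_l.+1 := ordS i0.
have i1E : i1 = 1%N :> nat by rewrite /= modn_small.
have neq : cyclic_segment k i0 != cyclic_segment k i1.
  apply/eqP => /setP /(_ i0) e01.
  have : i0 \in cyclic_segment k i0 by apply/imsetP; exists (Ordinal k0).
  rewrite e01 => /imsetP[j _ /(congr1 val)]; rewrite /= iterE i1E add1n.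
  by rewrite modn_small // ltnS (leq_trans (ltn_ord j)).
rewrite (cardsD1 (cyclic_segment k i0)) segk add1n ltnS card_gt0.
by apply/set0Pn; exists (cyclic_segment k i1); rewrite in_setD1 eq_sym neq segk.
Qed.

Lemma fractional_threshold_le (R : realType) (k : nat)
    (U : finType) (F : kgraph k U) (delta : R) :
  (1 < #|edges F|)%N -> suffices_for_decomposition F delta ->
  fractional_threshold R F <= delta.
Proof.
move=> F1; apply: ge_inf; exists 0 => d.
exact: suffices_for_decomposition_ge0.
Qed.

Lemma suffices_for_decomposition_threshold (R : realType) (k : nat)
    (U : finType) (F : kgraph k U) :
  (0 < k)%N -> (1 < #|edges F|)%N ->
  suffices_for_decomposition F (fractional_threshold R F).
Proof.
move=> k0 F1 mu mu0.
have mu2 : 0 < mu / 2 by rewrite divr_gt0.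
have [|d hd dlt] := @inf_adherent R
    [set delta : R | suffices_for_decomposition F delta]%classic _ mu2.
  split; first by exists 1; apply: suffices_for_decomposition1.
  by exists 0 => d; apply: suffices_for_decomposition_ge0.
have [n0 hn0] := hd _ mu2; exists n0 => V H nV hH; apply: hn0 => //.
apply: le_trans hH; apply: ler_wpM2r => //.
by rewrite [mu in leRHS]splitr addrA lerD2r ltW.
Qed.

(* Main.v *)
Require Import Defs.
From HB Require Import structures.
From mathcomp Require boolp.
From mathcomp Require Import classical_sets reals.
From mathcomp Require Import all_boot all_order all_algebra.
From mathcomp Require Import ring lra zify.

Set Implicit Arguments.
Unset Strict Implicit.
Unset Printing Implicit Defensive.

Import Order.TTheory GRing.Theory Num.Theory.

Local Open Scope ring_scope.

(** Walk on the ordered edges of H: from (v_1, ..., v_k) go to (v_2, ..., v_k, w) with w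
    uniform among the vertices completing {v_2, ..., v_k} to an edge. The uniform
    distribution is stationary, and as two (k-1)-sets have at least 2 eps n common
    completions, two walks can be coupled to meet after k steps with probability bounded
    below. Hence the closed walks of length l, weighted by the product of their transition
    probabilities, cover all edges almost equally, and the non-injective ones are negligible
    for large n.

    To correct the remaining error, replace a vertex c by c' in a closed walk
    z_1 ... z_(k-1) c z_k ... z_(2k-2) u: this changes the covering by
    the sum over the k windows t of z of [t + c] - [t + c']. Suitable signed combinations
    of such swaps, along walks in the common link of c and c', realize
    [t + c] - [t + c'] alone, with a density bounded independently of l. Averaging over c'
    gives f - P f for every function f on ordered edges, where P is the transition operator,
    and I - P is invertible modulo constants by mixing. The error, being exponentially small
    in l, can thus be removed without making any weight negative. *)

(** * Sums over tuples and products over windows *)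

(** Only sets have to be covered, but the unknown is a function on ordered edges, because the walk
    and hence [f - P f] need an order. The symmetry of the edge relation hides this order from the
    covering. Degrees above n/2 serve twice: they couple the walks, and they give the common link of
    [c] and [c'] linear minimum degree, so that walks inside it are spread out.

    Corrections are signed, so they must stay below a positive background: injective closed walks,
    each with N/l times its product of probabilities. A gadget costs up to K N times that product,
    which is l K times the background. This linear loss against the exponentially small mixing error
    determines l0; the collisions are dealt with afterwards, by taking n large in terms of l.

    Discarding non-injective walks destroys the exact identities satisfied by gadgets. Exactness is
    recovered without iteration: the covering produced by the truncated correction is a small linear
    perturbation of an operator with bounded inverse, hence injective, hence surjective in finite
    dimension, and the same a priori bound controls the size of the solution. *)

Section TupleSums.
Context (R : realFieldType) (V : finType).
Implicit Types (F G : seq V -> R) (s t u : seq V).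

Definition tsum (m : nat) (F : seq V -> R) : R := \sum_(t : m.-tuple V) F t.

Lemma eq_tsum m F G : (forall s, size s = m -> F s = G s) -> tsum m F = tsum m G.
Proof. by move=> FG; apply: eq_bigr => t _; rewrite FG ?size_tuple. Qed.

Lemma tsum0 F : tsum 0 F = F [::].
Proof.
rewrite /tsum (bigD1 [tuple]) //= big1 ?addr0 // => t /eqP[].
exact: tuple0.
Qed.

Lemma tsum_cat m p F : tsum (m + p) F = tsum m (fun s => tsum p (fun u => F (s ++ u))).
Proof.
rewrite /tsum pair_big /=.
have szt (w : (m + p).-tuple V) : size (take m w) == m.
  by rewrite size_takel // size_tuple leq_addr.
have szd (w : (m + p).-tuple V) : size (drop m w) == p.
  by rewrite size_drop size_tuple addKn.
rewrite (reindex (fun st : m.-tuple V * p.-tuple V => [tuple of st.1 ++ st.2])) //=.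
exists (fun w => (Tuple (szt w), Tuple (szd w))) => [[s u] _|w _].
  by congr (_, _); apply: val_inj; rewrite /= ?take_size_cat ?drop_size_cat ?size_tuple.
by apply: val_inj; rewrite /= cat_take_drop.
Qed.

Lemma tsum1 F : tsum 1 F = \sum_v F [:: v].
Proof.
rewrite /tsum (reindex (fun v => [tuple v])) //=.
exists (fun t : 1.-tuple V => thead t) => [v _|t _]; first by rewrite /thead (tnth_nth v).
rewrite [t in RHS]tuple_eta; apply: val_inj => /=; congr (_ :: _).
by rewrite [RHS](congr1 val (tuple0 [tuple of behead t])).
Qed.

Lemma tsumS m F : tsum m.+1 F = \sum_v tsum m (fun s => F (v :: s)).
Proof. by rewrite -add1n tsum_cat tsum1. Qed.

Lemma tsumSr m F : tsum m.+1 F = tsum m (fun s => \sum_v F (rcons s v)).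
Proof.
rewrite -addn1 tsum_cat; apply: eq_tsum => s _; rewrite tsum1.
by apply: eq_bigr => v _; rewrite cats1.
Qed.

Lemma exchange_tsum (I : finType) m (F : I -> seq V -> R) :
  \sum_i tsum m (F i) = tsum m (fun s => \sum_i F i s).
Proof. exact: exchange_big. Qed.

Lemma tsum_rot m i F : tsum m (fun s => F (rot i s)) = tsum m F.
Proof.
rewrite /tsum [RHS](reindex (fun t : m.-tuple V => [tuple of rot i t])) //=.
exists (fun t : m.-tuple V => [tuple of rotr i t]) => t _; apply: val_inj => /=.
  exact: rotK.
exact: rotrK.
Qed.

Lemma tsumD m F G : tsum m (fun s => F s + G s) = tsum m F + tsum m G.
Proof. exact: big_split. Qed.

Lemma tsumN m F : tsum m (fun s => - F s) = - tsum m F.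
Proof. exact: sumrN. Qed.

Lemma tsumB m F G : tsum m (fun s => F s - G s) = tsum m F - tsum m G.
Proof. by rewrite tsumD tsumN. Qed.

Lemma tsumZ m a F : tsum m (fun s => a * F s) = a * tsum m F.
Proof. by rewrite /tsum mulr_sumr. Qed.

Lemma tsum_eq0 m F : (forall s, size s = m -> F s = 0) -> tsum m F = 0.
Proof. by move=> F0; apply: big1 => t _; rewrite F0 ?size_tuple. Qed.

Lemma ler_tsum m F G :
  (forall s, size s = m -> F s <= G s) -> tsum m F <= tsum m G.
Proof. by move=> FG; apply: ler_sum => t _; rewrite FG ?size_tuple. Qed.

Lemma tsum_ge0 m F : (forall s, size s = m -> 0 <= F s) -> 0 <= tsum m F.
Proof. by move=> F0; apply: sumr_ge0 => t _; rewrite F0 ?size_tuple. Qed.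

Lemma ler_norm_tsum m F : `|tsum m F| <= tsum m (fun s => `|F s|).
Proof. exact: ler_norm_sum. Qed.

Lemma tsum_const m a : tsum m (fun=> a) = a *+ (#|V| ^ m).
Proof. by rewrite /tsum sumr_const card_tuple. Qed.

Lemma tsum_pred1 m F s : size s = m -> tsum m (fun t => (t == s)%:R * F t) = F s.
Proof.
move=> sm; rewrite /tsum (bigD1 (tcast sm (in_tuple s))) //= val_tcast eqxx mul1r.
rewrite big1 ?addr0 // => t /negbTE tneq.
have -> : (tval t == s) = false by rewrite -tneq -val_eqE /= val_tcast.
by rewrite mul0r.
Qed.

End TupleSums.

Section WindowProduct.
Context (R : realFieldType) (V : finType).
Variables (j : nat) (q : seq V -> R).
Implicit Types (s t u w : seq V).

(** A state of the walk is its last [j.+1] vertices, so [wprod (behead y ++ u)] is the probability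
    of continuing from the state [y] by the vertices [u]. The subtraction is truncated, which gives
    the empty product on short sequences. *)
Definition wprod s : R := \prod_(i < size s - j) q (take j.+1 (drop i s)).

Lemma wprod_short s : (size s <= j)%N -> wprod s = 1.
Proof.
move=> sj; apply: big1 => -[i /= i_lt]; lia.
Qed.

Lemma wprod_cons v s : (j <= size s)%N ->
  wprod (v :: s) = q (take j.+1 (v :: s)) * wprod s.
Proof. by move=> js; rewrite /wprod /= subSn // big_ord_recl. Qed.

(** Markov property: a window has [j.+1] vertices, so it cannot stick out of an overlap of size [j]
    on both sides, nor fit inside it. *)
Lemma wprod_cat w s u : size s = j ->
  wprod (w ++ s ++ u) = wprod (w ++ s) * wprod (s ++ u).
Proof.
move=> sj; elim: w => [|v w IH]; first by rewrite /= (@wprod_short s) ?sj // mul1r.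
rewrite /= !wprod_cons ?size_cat ?sj; [|lia..].
rewrite IH mulrA /= catA; congr (_ * _ * _); congr (q (v :: _)).
by rewrite takel_cat // size_cat sj leq_addl.
Qed.
End WindowProduct.

Section WindowProductTheory.
Context (R : realFieldType) (V : finType).
Variables (j : nat) (q : seq V -> R).
Implicit Types (s t u w x y z : seq V) (f F G psi : seq V -> R).
Local Notation wprod := (wprod j q).

Lemma wprod_window x : size x = j.+1 -> wprod x = q x.
Proof.
by move=> sx; rewrite /wprod sx subSnn big_ord1 drop0 take_oversize ?sx.
Qed.

Lemma wprod_ge0 s : (forall x, 0 <= q x) -> 0 <= wprod s.
Proof. by move=> q0; apply: prodr_ge0. Qed.

Lemma wprod_le b s : (forall x, 0 <= q x <= b) -> wprod s <= b ^+ (size s - j).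
Proof.
move=> qb; rewrite /wprod -[X in _ ^+ X]card_ord -prodr_const.
by apply: ler_prod.
Qed.

Lemma wprod_ge b s : 0 <= b ->
  (forall i, (i < size s - j)%N -> b <= q (take j.+1 (drop i s))) ->
  b ^+ (size s - j) <= wprod s.
Proof.
move=> b0 qb; rewrite /wprod -[X in _ ^+ X]card_ord -prodr_const.
by apply: ler_prod => i _; rewrite b0 qb.
Qed.

Lemma wprod_neq0 s i : (i < size s - j)%N -> wprod s != 0 ->
  q (take j.+1 (drop i s)) != 0.
Proof. by move=> is_lt /prodf_neq0 /(_ (Ordinal is_lt) isT). Qed.

Definition closed_wprod v : R := wprod (v ++ take j v).

(** A rotation by one position moves the factor of the first window to the end of the product. *)
Lemma closed_wprod_rot v i : (j < size v)%N ->
  closed_wprod (rot i v) = closed_wprod v.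
Proof.
have rot1 w : (j < size w)%N -> closed_wprod (rot 1 w) = closed_wprod w.
  case: w => [//|a w] /= jw; rewrite /closed_wprod rot1_cons -cats1.
  rewrite takel_cat // -catA /=.
  have jaw : size (take j (a :: w)) = j by rewrite size_takel // ltnW.
  rewrite -[a :: take j w]/(take j.+1 (a :: w)) -addn1 takeD wprod_cat //.
  have -> : take j (a :: w) ++ take 1 (drop j (a :: w)) = take j.+1 (a :: w).
    by rewrite -takeD addn1.
  rewrite (@wprod_window (take _ _)) ?size_takel // wprod_cons ?size_cat ?jaw ?leq_addl //.
  by rewrite mulrC /= takel_cat.
move=> jv; elim: i => [|i IH]; first by rewrite rot0.
case: (ltnP i (size v)) => [iv|iv]; last by rewrite rot_oversize // ltnW.
by rewrite rotS // rot1 ?size_rot.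
Qed.

Definition next_mean f x : R :=
  \sum_v q (rcons (behead x) v) * f (rcons (behead x) v).

Lemma iter_next_mean m f y : size y = j.+1 ->
  iter m next_mean f y =
  tsum m (fun u => wprod (behead y ++ u) * f (drop m (y ++ u))).
Proof.
elim: m y => [|m IH] y sy.
  by rewrite tsum0 /= !cats0 drop0 wprod_short ?mul1r // size_behead sy.
rewrite iterS tsumS /next_mean; apply: eq_bigr => v _.
rewrite IH; last by rewrite size_rcons size_behead sy.
rewrite -tsumZ; apply: eq_tsum => u su; rewrite mulrA; congr (_ * f _); last first.
  by case: y sy => //= a y _; rewrite cat_rcons.
case: y sy => //= a y [sy].
case: y sy => [|b y] sy /=; first by rewrite wprod_cons -?sy //= take0.
rewrite wprod_cons ?size_cat /= -?sy /=; last by rewrite addnS ltnS leq_addr.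
by rewrite -cat_rcons takel_cat ?size_rcons // take_oversize ?size_rcons.
Qed.

(** Adjoint of [next_mean]: it transports a (possibly signed) weight on states one step forward,
    [a :: take j y] running over the predecessors of [y]. *)
Definition push psi y : R := q y * \sum_a psi (a :: take j y).

Lemma tsum_push m psi G :
  tsum (j.+1 + m).+1 (fun z => psi (take j.+1 z) * wprod (behead z) * G (behead z))
  = tsum (j.+1 + m) (fun z => push psi (take j.+1 z) * wprod (behead z) * G z).
Proof.
rewrite tsumS exchange_tsum; apply: eq_tsum => z sz /=.
rewrite /push -!mulr_suml; congr (_ * _).
case: z sz => [//|b z] [sz]; rewrite wprod_cons ?sz ?leq_addr //.
rewrite take_takel // mulrA; congr (_ * _); exact: mulrC.
Qed.

Variable S : pred (seq V).
Hypothesis next1 : forall x, size x = j.+1 -> S x ->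
  \sum_v q (rcons (behead x) v) = 1.
Hypothesis qS : forall x, size x = j.+1 -> q x != 0 -> S x.

Lemma iter_next_mean1 m x : size x = j.+1 -> S x -> iter m next_mean (fun=> 1) x = 1.
Proof.
elim: m x => [//|m IH] x sx Sx; rewrite iterS /next_mean -[RHS](next1 sx Sx).
apply: eq_bigr => v _.
have sxv : size (rcons (behead x) v) = j.+1 by rewrite size_rcons size_behead sx.
have [->|qn0] := eqVneq (q (rcons (behead x) v)) 0; first by rewrite mul0r.
by rewrite IH ?mulr1 // qS.
Qed.

(** The steps before the window read by [F] are absorbed into the weight by [tsum_push]; those after
    it sum to 1. [S] confines the walk to states from which the probabilities do add up to 1. *)
Lemma tsum_window m i psi F : (i <= m)%N ->
  (forall x, size x = j.+1 -> psi x != 0 -> S x) ->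
  tsum (j.+1 + m) (fun z => psi (take j.+1 z) * wprod (behead z) * F (take j.+1 (drop i z)))
  = tsum j.+1 (fun x => iter i push psi x * F x).
Proof.
elim: i m psi => [|i IH] m psi im psiS.
  rewrite tsum_cat; apply: eq_tsum => x sx /=.
  have [p0|pn0] := eqVneq (psi x) 0.
    by rewrite p0 mul0r tsum_eq0 // => u _; rewrite take_size_cat // p0 !mul0r.
  rewrite -[RHS]mulr1 -(iter_next_mean1 m sx (psiS _ sx pn0)) iter_next_mean // -tsumZ.
  apply: eq_tsum => u _; rewrite drop0 take_size_cat // mulr1 mulrAC.
  by case: x sx {pn0} => //= a x _.
case: m im => // m im; rewrite addnS.
rewrite -(eq_tsum (F := fun z => psi (take j.+1 z) * wprod (behead z)
   * (fun z => F (take j.+1 (drop i z))) (behead z))); last first.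
  by move=> [|a z].
rewrite (tsum_push _ _ (fun z => F (take j.+1 (drop i z)))) IH //.
  by apply: eq_tsum => x _; rewrite iterSr.
by move=> x sx; rewrite mulf_eq0 negb_or => /andP[/qS->].
Qed.

End WindowProductTheory.

(** * Mixing of the tight random walk *)

(* p1 and p2 are coupled so that they agree with the sub-distribution o. *)
Lemma coupling_bound (R : realFieldType) (I : finType) (p1 p2 o f1 f2 : I -> R) a D g b :
  (forall i, 0 <= o i) -> (forall i, o i <= p1 i) -> (forall i, o i <= p2 i) ->
  \sum_i p1 i = 1 -> \sum_i p2 i = 1 -> g <= \sum_i o i ->
  (forall i, 0 < p1 i -> f1 i <= a + D) -> (forall i, 0 < p2 i -> a <= f2 i) ->
  (forall i, 0 < o i -> f1 i - f2 i <= (1 - b) * D) -> 0 <= b -> 0 <= D ->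
  \sum_i p1 i * f1 i - \sum_i p2 i * f2 i <= (1 - g * b) * D.
Proof.
move=> o0 o1 o2 s1 s2 go f1D f2a f12 b0 D0.
(* On the overlap the difference is at most [(1 - b) * D]; the two remainders have the same mass and
   contribute at most [D] per unit of it. *)
have -> : \sum_i p1 i * f1 i - \sum_i p2 i * f2 i =
    \sum_i o i * (f1 i - f2 i) + \sum_i (p1 i - o i) * f1 i - \sum_i (p2 i - o i) * f2 i.
  by rewrite -big_split -!sumrB; apply: eq_bigr => i _ /=; ring.
have h1 : \sum_i o i * (f1 i - f2 i) <= (\sum_i o i) * ((1 - b) * D).
  rewrite mulr_suml; apply: ler_sum => i _.
  have [<-|oi] := eqVneq 0 (o i); first by rewrite !mul0r.
  by rewrite ler_wpM2l // f12 // lt_neqAle oi o0.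
have h2 : \sum_i (p1 i - o i) * f1 i <= (1 - \sum_i o i) * (a + D).
  rewrite -s1 -sumrB mulr_suml; apply: ler_sum => i _.
  have [<-|pi] := eqVneq (o i) (p1 i); first by rewrite subrr !mul0r.
  rewrite ler_wpM2l ?subr_ge0 // f1D // (le_lt_trans (o0 i)) //.
  by rewrite lt_neqAle pi o1.
have h3 : (1 - \sum_i o i) * a <= \sum_i (p2 i - o i) * f2 i.
  rewrite -s2 -sumrB mulr_suml; apply: ler_sum => i _.
  have [<-|pi] := eqVneq (o i) (p2 i); first by rewrite subrr !mul0r.
  rewrite ler_wpM2l ?subr_ge0 // f2a // (le_lt_trans (o0 i)) //.
  by rewrite lt_neqAle pi o2.
have h4 : g * (b * D) <= (\sum_i o i) * (b * D) by rewrite ler_wpM2r // mulr_ge0.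
lra.
Qed.

Section TightWalk.
Context (R : realFieldType) (V : finType).
Variables (j : nat) (E : seq V -> bool) (g : R).
Implicit Types (s t u w x y z : seq V) (f : seq V -> R) (m : nat).

Definition deg t : R := \sum_v (E (v :: t))%:R.

(** Indexed by the state reached: the state left matters only through its last [j] vertices, which
    are [take j x]. *)
Definition tight_prob x : R := (E x)%:R / deg (take j x).

Local Notation n := (#|V|%:R : R).
Local Notation P := (next_mean tight_prob).

Hypothesis E_perm : forall s t, perm_eq s t -> E s = E t.
Hypothesis E_uniq : forall s, E s -> uniq s.
Hypothesis E_size : forall s, E s -> size s = j.+1.
Hypothesis g_gt0 : 0 < g.
Hypothesis g_lt1 : g < 1.
Hypothesis V_gt0 : 0 < n.
Hypothesis deg_ge : forall t, size t = j -> uniq t -> (1 + g) / 2 * n <= deg t.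

Lemma E_rcons t v : E (rcons t v) = E (v :: t).
Proof. by apply: E_perm; rewrite perm_rcons. Qed.

Lemma deg_le t : deg t <= n.
Proof.
rewrite -[n]sumr_const; apply: ler_sum => v _; by rewrite lern1 leq_b1.
Qed.

Lemma E_deg_ge v t : E (v :: t) -> (1 + g) / 2 * n <= deg t.
Proof.
by move=> Evt; have [st] := E_size Evt; have /= /andP[_ ut] := E_uniq Evt; exact: deg_ge.
Qed.

Lemma half_le_deg v t : E (v :: t) -> n / 2 <= deg t.
Proof.
move=> /E_deg_ge; have : 0 < g * n by rewrite mulr_gt0.
lra.
Qed.

Lemma E_deg_gt0 v t : E (v :: t) -> 0 < deg t.
Proof. by move=> /half_le_deg; apply: lt_le_trans; rewrite divr_gt0. Qed.

Lemma tight_prob_rcons t v : size t = j ->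
  tight_prob (rcons t v) = (E (v :: t))%:R / deg t.
Proof. by move=> st; rewrite /tight_prob E_rcons -cats1 take_size_cat. Qed.

Lemma deg_ge0 t : 0 <= deg t. Proof. by apply: sumr_ge0 => v _; apply: ler0n. Qed.

Lemma tight_prob_ge0 x : 0 <= tight_prob x.
Proof. by rewrite divr_ge0 ?ler0n ?deg_ge0. Qed.

Lemma E_split x : E x -> exists t v, [/\ x = rcons t v, size t = j & E (v :: t)].
Proof.
move=> Ex; have := E_size Ex; case/lastP: x Ex => // t v.
by rewrite E_rcons size_rcons => Evt [st]; exists t, v.
Qed.

Lemma tight_prob_bounds x : E x -> n^-1 <= tight_prob x <= 2 / n.
Proof.
case/E_split => t [v [-> st Evt]]; rewrite tight_prob_rcons // Evt mul1r.
rewrite lef_pV2 ?posrE ?(E_deg_gt0 Evt) // deg_le /= -invf_div.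
by rewrite lef_pV2 ?posrE ?(E_deg_gt0 Evt) ?divr_gt0 // (half_le_deg Evt).
Qed.

Lemma tight_prob_le x : tight_prob x <= 2 / n.
Proof.
have [/tight_prob_bounds/andP[]//|NEx] := boolP (E x).
by rewrite /tight_prob (negbTE NEx) mul0r divr_ge0 // ltW.
Qed.

Lemma tight_prob_neq0 x : tight_prob x != 0 -> E x.
Proof. by apply: contra_neqT => /negbTE; rewrite /tight_prob => ->; rewrite mul0r. Qed.

Lemma E_behead_size x : E x -> size (behead x) = j.
Proof. by move=> /E_size; rewrite size_behead => ->. Qed.

Lemma E_behead_uniq x : E x -> uniq (behead x).
Proof. by move=> /E_uniq; case: x => //= a x /andP[]. Qed.

Lemma sum_tight_prob_rcons t : size t = j -> uniq t -> \sum_v tight_prob (rcons t v) = 1.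
Proof.
move=> st ut; under eq_bigr do rewrite tight_prob_rcons //.
rewrite -mulr_suml mulfV // gt_eqF //; apply: lt_le_trans (deg_ge st ut).
by rewrite mulr_gt0 // divr_gt0 // addr_gt0.
Qed.

Lemma sum_tight_prob x : E x -> \sum_v tight_prob (rcons (behead x) v) = 1.
Proof. by move=> Ex; rewrite sum_tight_prob_rcons ?E_behead_size ?E_behead_uniq. Qed.

(** Inclusion-exclusion. This is how a degree above n/2 turns into a linear overlap. *)
Lemma common_nbrs t1 t2 : size t1 = j -> uniq t1 -> size t2 = j -> uniq t2 ->
  g * n <= \sum_v (E (v :: t1) && E (v :: t2))%:R.
Proof.
move=> s1 u1 s2 u2.
have : deg t1 + deg t2 - n <= \sum_v (E (v :: t1) && E (v :: t2))%:R.
  rewrite /deg -[n]sumr_const -big_split -sumrB; apply: ler_sum => v _ /=.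
  by case: (E _); case: (E _); rewrite /=; lra.
have := deg_ge s1 u1; have := deg_ge s2 u2; lra.
Qed.

Lemma next_mean_le f b x : (forall y, E y -> f y <= b) -> E x -> P f x <= b.
Proof.
move=> fb Ex; rewrite -[b]mul1r -(sum_tight_prob Ex) mulr_suml; apply: ler_sum => v _.
have [->|qn0] := eqVneq (tight_prob (rcons (behead x) v)) 0; first by rewrite !mul0r.
by rewrite ler_wpM2l ?tight_prob_ge0 // fb // tight_prob_neq0.
Qed.

Lemma next_mean_ge f b x : (forall y, E y -> b <= f y) -> E x -> b <= P f x.
Proof.
move=> fb Ex; rewrite -[b]mul1r -(sum_tight_prob Ex) mulr_suml; apply: ler_sum => v _.
have [->|qn0] := eqVneq (tight_prob (rcons (behead x) v)) 0; first by rewrite !mul0r.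
by rewrite ler_wpM2l ?tight_prob_ge0 // fb // tight_prob_neq0.
Qed.

Lemma iter_next_mean_le m f b x : (forall y, E y -> f y <= b) -> E x -> iter m P f x <= b.
Proof. by move=> fb; elim: m x => [|m IH] x; [apply: fb | apply: next_mean_le]. Qed.

Lemma iter_next_mean_ge m f b x : (forall y, E y -> b <= f y) -> E x -> b <= iter m P f x.
Proof. by move=> fb; elim: m x => [|m IH] x; [apply: fb | apply: next_mean_ge]. Qed.

Definition osc_le f D := forall x y, E x -> E y -> f x - f y <= D.

Lemma min_on_edges f x : E x -> exists2 x0, E x0 & forall y, E y -> f x0 <= f y.
Proof.
move=> Ex; have szx := E_size Ex.
pose x' : j.+1.-tuple V := tcast szx (in_tuple x).
have Ex' : E x' by rewrite val_tcast.
case: (@arg_minP _ _ _ x' (fun x : j.+1.-tuple V => E x) (fun x : j.+1.-tuple V => f x) Ex').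
move=> x0 Ex0 min0; exists x0 => // y Ey.
have := min0 (tcast (E_size Ey) (in_tuple y)); rewrite val_tcast /=; exact.
Qed.

(** [m] counts the leading vertices in which the two states may differ. Moving both to a common next
    vertex succeeds with probability at least [g] and lowers [m] by one. *)
Lemma osc_le_next_common m f D x y : (m <= j.+1)%N -> osc_le f D -> E x -> E y ->
  drop m x = drop m y -> iter m P f x - iter m P f y <= (1 - g ^+ m) * D.
Proof.
move=> mj fD Ex Ey; have [x0 Ex0 fx0] := min_on_edges f Ex.
have D0 : 0 <= D by have := fD x0 x0 Ex0 Ex0; rewrite subrr.
elim: m mj x y Ex Ey => [|m IH] mj x y Ex Ey.
  by rewrite !drop0 => -> /=; rewrite subrr expr0 subrr mul0r.
move=> xy; rewrite !iterS /next_mean exprS.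
(* Each common completion has probability at least 1/n from both states, as degrees are at most n;
   this is the overlap used. *)
apply: (@coupling_bound _ _ _ _
   (fun v => (E (v :: behead x) && E (v :: behead y))%:R / n) _ _ (f x0)) => //.
- by move=> v; rewrite divr_ge0 ?ler0n // ltW.
- move=> v; rewrite tight_prob_rcons ?E_behead_size //.
  case Ev: (E _) => /=; last by rewrite !mul0r.
  apply: ler_pM; rewrite ?ler0n ?invr_ge0 ?(ltW V_gt0) ?lern1 ?leq_b1 //.
  by rewrite lef_pV2 ?posrE ?deg_le // (E_deg_gt0 Ev).
- move=> v; rewrite tight_prob_rcons ?E_behead_size // andbC.
  case Ev: (E _) => /=; last by rewrite !mul0r.
  apply: ler_pM; rewrite ?ler0n ?invr_ge0 ?(ltW V_gt0) ?lern1 ?leq_b1 //.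
  by rewrite lef_pV2 ?posrE ?deg_le // (E_deg_gt0 Ev).
- exact: sum_tight_prob.
- exact: sum_tight_prob.
- by rewrite -mulr_suml ler_pdivlMr // common_nbrs ?E_behead_size ?E_behead_uniq.
- move=> v q0; apply: iter_next_mean_le => [z Ez|]; last by rewrite tight_prob_neq0 ?gt_eqF.
  by have := fD z x0 Ez Ex0; rewrite lerBlDl.
- by move=> v q0; apply: iter_next_mean_ge => //; rewrite tight_prob_neq0 ?gt_eqF.
- move=> v; case Ev: (_ && _) => /=; last by rewrite mul0r ltxx.
  case/andP: Ev => Exv Eyv _; apply: IH; rewrite ?E_rcons ?(ltnW mj) //.
  rewrite !drop_rcons ?E_behead_size // ; congr rcons.
  by case: x y xy {Ex Ey Exv Eyv} => [|a x] [|b y].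
- by rewrite exprn_ge0 // ltW.
Qed.

Lemma osc_le_iter f D : osc_le f D -> osc_le (iter j.+1 P f) ((1 - g ^+ j.+1) * D).
Proof.
move=> fD x y Ex Ey; apply: osc_le_next_common => //.
by rewrite !drop_oversize ?E_size.
Qed.

Lemma osc_le_iterM f D i m : osc_le f D -> (j.+1 * i <= m)%N ->
  osc_le (iter m P f) ((1 - g ^+ j.+1) ^+ i * D).
Proof.
move=> fD; elim: i m => [|i IH] m im.
  (* Steps in excess of a multiple of [j.+1] only average, so they do not increase the
     oscillation. *)
  have mono k : osc_le (iter k P f) D.
    elim: k => [//|k IH] x y Ex Ey; have [x0 Ex0 fx0] := min_on_edges (iter k P f) Ex.
    have := next_mean_ge fx0 Ey.
    have /= : P (iter k P f) x <= iter k P f x0 + D.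
      by apply: next_mean_le => // z Ez; have := IH _ _ Ez Ex0; rewrite lerBlDl.
    lra.
  by rewrite expr0 mul1r; exact: mono.
have -> : m = (j.+1 + (m - j.+1))%N by lia.
rewrite iterD exprS -mulrA; apply: osc_le_iter; apply: IH; lia.
Qed.

Definition num_edges : R := tsum j.+1 (fun x => (E x)%:R).

Definition edge_mean f : R := tsum j.+1 (fun x => (E x)%:R * f x) / num_edges.

(** Stationarity of the uniform distribution: [rcons t v] is entered from the [deg t] states
    [a :: t], each time with probability [1 / deg t]. In- and out-degrees agree because [E] is
    symmetric. *)
Lemma tsum_next_mean f :
  tsum j.+1 (fun x => (E x)%:R * P f x) = tsum j.+1 (fun x => (E x)%:R * f x).
Proof.
rewrite tsumS exchange_tsum tsumSr; apply: eq_tsum => t st /=.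
transitivity (deg t * \sum_v tight_prob (rcons t v) * f (rcons t v)).
  by rewrite /deg mulr_suml.
rewrite mulr_sumr; apply: eq_bigr => v _.
rewrite tight_prob_rcons // E_rcons; case Ev: (E _); last by rewrite !mul0r mulr0.
by rewrite !mul1r mulrA mulfV ?mul1r // gt_eqF // (E_deg_gt0 Ev).
Qed.

Lemma edge_mean_iter m f : edge_mean (iter m P f) = edge_mean f.
Proof. by elim: m => //= m IH; rewrite /edge_mean tsum_next_mean. Qed.

Lemma num_edges_gt0 x : E x -> 0 < num_edges.
Proof.
move=> Ex; rewrite /num_edges /tsum (bigD1 (tcast (E_size Ex) (in_tuple x))) //=.
by rewrite val_tcast Ex ltr_pwDl // sumr_ge0.
Qed.

Lemma num_edges_le : num_edges <= n ^+ j.+1.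
Proof.
apply: (@le_trans _ _ (tsum j.+1 (fun=> 1))).
  by apply: ler_tsum => s _; rewrite lern1 leq_b1.
by rewrite tsum_const natrX.
Qed.

Lemma edge_mean_le f b x : E x -> (forall y, E y -> f y <= b) -> edge_mean f <= b.
Proof.
move=> Ex fb; rewrite ler_pdivrMr ?(num_edges_gt0 Ex) // -tsumZ.
apply: ler_tsum => s _; rewrite mulrC; case Es: (E s); last by rewrite !mulr0.
by rewrite !mulr1 fb.
Qed.

Lemma edge_mean_ge f b x : E x -> (forall y, E y -> b <= f y) -> b <= edge_mean f.
Proof.
move=> Ex fb; rewrite ler_pdivlMr ?(num_edges_gt0 Ex) // -tsumZ.
apply: ler_tsum => s _; rewrite [leRHS]mulrC; case Es: (E s); last by rewrite !mulr0.
by rewrite !mulr1 fb.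
Qed.

Lemma edge_mean_osc f D x : osc_le f D -> E x -> `|f x - edge_mean f| <= D.
Proof.
move=> fD Ex; rewrite ler_norml; apply/andP; split.
  suff : edge_mean f <= f x + D by lra.
  by apply: (edge_mean_le Ex) => y Ey; have := fD y x Ey Ex; lra.
suff : f x - D <= edge_mean f by lra.
by apply: (edge_mean_ge Ex) => y Ey; have := fD x y Ex Ey; lra.
Qed.

Lemma edge_mean_norm f b x : E x -> (forall y, E y -> `|f y| <= b) -> `|edge_mean f| <= b.
Proof.
move=> Ex fb; rewrite ler_norml; apply/andP; split.
  by apply: (edge_mean_ge Ex) => y /fb; rewrite ler_norml => /andP[].
by apply: (edge_mean_le Ex) => y /fb; rewrite ler_norml => /andP[].
Qed.

Lemma next_mean_norm f b x : (forall y, E y -> `|f y| <= b) -> E x -> `|P f x| <= b.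
Proof.
move=> fb Ex; rewrite ler_norml; apply/andP; split.
  by apply: next_mean_ge => // y /fb; rewrite ler_norml => /andP[].
by apply: next_mean_le => // y /fb; rewrite ler_norml => /andP[].
Qed.

Lemma next_meanB f1 f2 x : P (fun y => f1 y - f2 y) x = P f1 x - P f2 x.
Proof. by rewrite -sumrB; apply: eq_bigr => v _; rewrite mulrBr. Qed.

End TightWalk.

(** * Convergence to the uniform distribution and inversion of [I - P + J] *)

Section Mixing.
Context (R : realFieldType) (V : finType).
Variables (j : nat) (E : seq V -> bool) (g : R).
Implicit Types (s t u w x y z : seq V) (f h : seq V -> R) (m i : nat).

Local Notation n := (#|V|%:R : R).
Local Notation q := (tight_prob R j E).
Local Notation P := (next_mean q).
Local Notation N := (num_edges R j E).
Local Notation J := (edge_mean j E).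
Local Notation theta := (1 - g ^+ j.+1).

Hypothesis E_perm : forall s t, perm_eq s t -> E s = E t.
Hypothesis E_uniq : forall s, E s -> uniq s.
Hypothesis E_size : forall s, E s -> size s = j.+1.
Hypothesis g_gt0 : 0 < g.
Hypothesis g_lt1 : g < 1.
Hypothesis V_gt0 : 0 < n.
Hypothesis deg_ge : forall t, size t = j -> uniq t -> (1 + g) / 2 * n <= deg R E t.

Let qP x : 0 <= q x <= 2 / n.
Proof. by rewrite tight_prob_ge0 (tight_prob_le E_perm E_uniq E_size g_gt0). Qed.

Lemma iter_next_mean_delta m x y : size x = j.+1 -> size y = j.+1 ->
  iter (m + j.+1) P (fun z => (z == x)%:R) y =
  tsum m (fun u => wprod j q (behead y ++ u ++ x)).
Proof.
move=> sx sy; rewrite (@iter_next_mean _ _ j) // tsum_cat; apply: eq_tsum => u su.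
rewrite -(tsum_pred1 (fun x => wprod j q (behead y ++ u ++ x)) sx).
apply: eq_tsum => x' sx'; rewrite mulrC; congr ((_ == _)%:R * _).
by rewrite catA drop_size_cat // size_cat sy su addnC.
Qed.

(** The first [j.+1] steps flatten the point mass to values at most [(2 / n) ^+ j.+1], and each
    further block of [j.+1] steps contracts. The relative error is free of n because N is at most
    [n ^+ j.+1]. *)
Lemma mixing i m x y : E x -> E y -> (j.+1 * i.+1 <= m)%N ->
  `|iter m P (fun z => (z == x)%:R) y - N^-1| <= theta ^+ i * 2 ^+ j.+1 / N.
Proof.
move=> Ex Ey im; have N0 : 0 < N := num_edges_gt0 R E_size Ex.
have th0 : 0 <= theta by rewrite subr_ge0 exprn_ile1 // ltW.
set f := fun z => _; set b : R := (2 / n) ^+ j.+1.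
have fb z : E z -> 0 <= iter j.+1 P f z <= b.
  move=> Ez; rewrite -[j.+1]add0n iter_next_mean_delta ?E_size // tsum0 /=.
  rewrite wprod_ge0 => [|w]; last by case/andP: (qP w).
  apply: le_trans (wprod_le _ _ qP) _.
  by rewrite size_cat (E_behead_size E_size Ez) (E_size Ex) addKn.
have fosc : osc_le E (iter j.+1 P f) b.
  move=> z1 z2 /fb/andP[z10 z1b] /fb/andP[z20 z2b]; lra.
have := osc_le_iterM E_perm E_uniq E_size g_gt0 g_lt1 V_gt0 deg_ge fosc
  (i := i) (m := m - j.+1).
rewrite -iterD subnK; last by apply: leq_trans im; rewrite mulnS leq_addr.
have -> : (j.+1 * i <= m - j.+1)%N by rewrite leq_subRL -?mulnS //; lia.
move=> /(_ isT) /(edge_mean_osc E_size) /(_ Ey).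
rewrite (edge_mean_iter E_perm E_uniq E_size g_gt0 V_gt0 deg_ge).
have -> : J f = N^-1.
  rewrite /edge_mean -[RHS]mul1r; congr (_ / _).
  transitivity (tsum j.+1 (fun s => f s * (E s)%:R)).
    by apply: eq_tsum => s _; exact: mulrC.
  by rewrite tsum_pred1 ?E_size ?Ex.
move/le_trans; apply; rewrite -mulrA ler_wpM2l ?exprn_ge0 //.
rewrite /b expr_div_n ler_wpM2l ?exprn_ge0 // lef_pV2 ?posrE ?exprn_gt0 //.
exact: num_edges_le.
Qed.

(* J (h - P h + J h) = J h, since J P = J; then h - P^k h is a sum of k terms of the form
   P^i (h - P h), and P^k contracts oscillations. *)
Lemma poisson_bound h (b : R) : (forall x, E x -> `|h x - P h x + J h| <= b) ->
  forall x, E x -> `|h x| <= (1 + (4 * j.+1)%:R / g ^+ j.+1) * b.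
Proof.
move=> hb x Ex.
have b0 : 0 <= b := le_trans (normr_ge0 _) (hb x Ex).
have Jh : `|J h| <= b.
  have -> : J h = J (fun y => h y - P h y + J h); last exact: edge_mean_norm Ex hb.
  rewrite /edge_mean.
  have -> : tsum j.+1 (fun y => (E y)%:R * (h y - P h y + tsum j.+1 (fun z => (E z)%:R * h z) / N))
     = tsum j.+1 (fun y => (E y)%:R * h y) - tsum j.+1 (fun y => (E y)%:R * P h y)
       + (tsum j.+1 (fun y => (E y)%:R * h y) / N) * N.
    by rewrite -tsumZ -tsumB -tsumD; apply: eq_tsum => s _; ring.
  rewrite (tsum_next_mean E_perm E_uniq E_size g_gt0 V_gt0 deg_ge) subrr add0r.
  by rewrite divfK // gt_eqF // (num_edges_gt0 R E_size Ex).
have hPh y : E y -> `|h y - P h y| <= 2 * b.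
  move=> Ey; have -> : h y - P h y = (h y - P h y + J h) - J h by rewrite addrK.
  by apply: le_trans (ler_normB _ _) _; rewrite mulr2n mulrDl mul1r lerD // hb.
have hPi i y : E y -> `|h y - iter i P h y| <= i%:R * (2 * b).
  elim: i y => [|i IH] y Ey; first by rewrite subrr normr0 mul0r.
  have -> : h y - iter i.+1 P h y = (h y - P h y) + P (fun y => h y - iter i P h y) y.
    by rewrite next_meanB iterS; ring.
  apply: le_trans (ler_normD _ _) _; rewrite -natr1 mulrDl mul1r addrC lerD ?hPh //.
  exact: (next_mean_norm E_perm E_uniq E_size g_gt0 V_gt0 deg_ge).
have [y Ey hy] := min_on_edges E_size h Ex.
have [z Ez hz] := min_on_edges E_size (fun z => - h z) Ex.
set D := h z - h y.
have hD : osc_le E h D.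
  by move=> z1 z2 Ez1 Ez2; have := hz _ Ez1; have := hy _ Ez2; rewrite /D; lra.
have := osc_le_iter E_perm E_uniq E_size g_gt0 V_gt0 deg_ge hD Ez Ey.
move=> zy.
have := hPi j.+1 y Ey; rewrite ler_norml => /andP[y1 y2].
have := hPi j.+1 z Ez; rewrite ler_norml => /andP[z1 z2].
(* In [j.+1] steps the maximum and the minimum each move by at most [j.+1 * (2 * b)], while their
   gap must shrink by the factor [1 - g ^+ j.+1]. *)
have gD : g ^+ j.+1 * D <= (4 * j.+1)%:R * b.
  rewrite natrM; move: zy y1 y2 z1 z2; rewrite /D; lra.
have {}gD : D <= (4 * j.+1)%:R / g ^+ j.+1 * b.
  by rewrite mulrAC ler_pdivlMr ?exprn_gt0 // mulrC.
rewrite -[h x](subrK (J h)).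
apply: le_trans (ler_normD _ _) _.
by rewrite mulrDl mul1r addrC lerD // (le_trans (edge_mean_osc E_size hD Ex)).
Qed.

End Mixing.

(** * Walks in the common link of two vertices *)

(** Abel summation. It dictates the coefficients of [spread], which trade the later windows of a
    walk for copies of the first one. *)
Lemma weighted_telescope (R : realFieldType) (e : nat -> R) m :
  \sum_(i < m.+1) e i + \sum_(i < m) (m - i)%:R * (e i - e i.+1) = m.+1%:R * e 0.
Proof.
elim: m => [|m IH]; first by rewrite big_ord1 big_ord0 addr0 mul1r.
have -> : \sum_(i < m.+1) (m.+1 - i)%:R * (e i - e i.+1) =
    \sum_(i < m) (m - i)%:R * (e i - e i.+1) + \sum_(i < m.+1) (e i - e i.+1).
  have -> : \sum_(i < m) (m - i)%:R * (e i - e i.+1) =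
      \sum_(i < m.+1) (m - i)%:R * (e i - e i.+1).
    by rewrite big_ord_recr /= subnn mul0r addr0.
  rewrite -big_split; apply: eq_bigr => i _ /=.
  have im : (i <= m)%N by rewrite -ltnS.
  by rewrite subSn // -natr1 mulrDl mul1r.
have -> : \sum_(i < m.+1) (e i - e i.+1) = e 0 - e m.+1.
  elim: m.+1 => [|p IHp]; first by rewrite big_ord0 subrr.
  by rewrite big_ord_recr IHp /= addrA subrK.
rewrite big_ord_recr /= -[m.+2%:R]natr1 mulrDl -IH mul1r.
by rewrite addrACA [e m.+1 + _]addrC subrK.
Qed.

Section LinkWalk.
Context (R : realFieldType) (V : finType).
Variables (b : nat) (L : seq V -> bool).
Implicit Types (B : R) (s t u w x y z : seq V) (psi phi Y : seq V -> R).

Local Notation degL := (deg R L).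
Local Notation qL := (tight_prob R b L).
Local Notation pushL := (push b qL).

(** Redraws the first vertex given the others. Like [push] it forgets the first vertex and draws a
    completion, but it puts it in front, not at the end; a symmetric test function cannot tell the
    two apart. *)
Definition resample psi t : R :=
  (L t)%:R / degL (behead t) * \sum_a psi (a :: behead t).

Definition spread psi t : R :=
  psi t + \sum_(i < b.+1) (b.+1 - i)%:R * (iter i pushL psi t - resample (iter i pushL psi) t).

Definition walk_weight psi z : R := spread psi (take b.+1 z) * wprod b qL (behead z).

Lemma push_lin a phi psi y :
  pushL (fun y => a * phi y + psi y) y = a * pushL phi y + pushL psi y.
Proof. by rewrite /push big_split -mulr_sumr /=; ring. Qed.

Lemma eq_push phi psi y : phi =1 psi -> pushL phi y = pushL psi y.
Proof. by move=> e; rewrite /push; under eq_bigr do rewrite e. Qed.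

Lemma iter_push_lin a phi psi i y :
  iter i pushL (fun y => a * phi y + psi y) y = a * iter i pushL phi y + iter i pushL psi y.
Proof. by elim: i y => //= i IH y; rewrite (eq_push _ IH) push_lin. Qed.

Lemma resample_lin a phi psi y :
  resample (fun y => a * phi y + psi y) y = a * resample phi y + resample psi y.
Proof. by rewrite /resample big_split -mulr_sumr /=; ring. Qed.

Lemma eq_resample phi psi y : phi =1 psi -> resample phi y = resample psi y.
Proof. by move=> e; rewrite /resample; under eq_bigr do rewrite e. Qed.

Lemma spread_lin a phi psi y :
  spread (fun y => a * phi y + psi y) y = a * spread phi y + spread psi y.
Proof.
rewrite /spread mulrDr mulr_sumr addrACA -big_split; congr (_ + _).
apply: eq_bigr => i _ /=.
by rewrite iter_push_lin (eq_resample _ (iter_push_lin _ _ _ _)) resample_lin; ring.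
Qed.

Lemma walk_weight_lin a phi psi z :
  walk_weight (fun y => a * phi y + psi y) z = a * walk_weight phi z + walk_weight psi z.
Proof. by rewrite /walk_weight spread_lin; ring. Qed.

(* If degL (take b y) = 0 then qL y = 0, as x / 0 = 0. *)
Lemma push_resample phi y : pushL (fun t => phi t - resample phi t) y = 0.
Proof.
rewrite /push; set t := take b y; rewrite sumrB.
have -> : \sum_a resample phi (a :: t) = (degL t / degL t) * \sum_a phi (a :: t).
  by under eq_bigr do rewrite /resample /=; rewrite -!mulr_suml.
have [d0|d0] := eqVneq (degL t) 0; first by rewrite /tight_prob -/t d0 invr0 mulr0 mul0r.
by rewrite mulfV // mul1r subrr mulr0.
Qed.

Lemma iter_push0 psi i y : (forall t, psi t = 0) -> iter i pushL psi y = 0.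
Proof.
move=> p0; elim: i y => //= i IH y; rewrite /push big1 ?mulr0 // => a _; exact: IH.
Qed.

Lemma iter_push_resample phi i y : iter i.+1 pushL (fun t => phi t - resample phi t) y = 0.
Proof. by rewrite iterSr iter_push0 // => t; exact: push_resample. Qed.

Hypothesis L_perm : forall s t, perm_eq s t -> L s = L t.

Let Lrcons t v : L (rcons t v) = L (v :: t).
Proof. by apply: L_perm; rewrite perm_rcons. Qed.

Lemma tsum_resample phi Y : (forall s t, perm_eq s t -> Y s = Y t) ->
  tsum b.+1 (fun t => resample phi t * Y t) = tsum b.+1 (fun t => pushL phi t * Y t).
Proof.
move=> Y_perm; rewrite tsumS exchange_tsum tsumSr; apply: eq_tsum => t st.
apply: eq_bigr => v _; have vt : perm_eq (rcons t v) (v :: t) by rewrite perm_rcons.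
rewrite (Y_perm _ _ vt) /push /resample /tight_prob (L_perm vt).
by rewrite -cats1 take_size_cat.
Qed.

Variable d : R.
Hypothesis d_gt0 : 0 < d.
Hypothesis L_size : forall s, L s -> size s = b.+1.
Hypothesis L_deg : forall v t, L (v :: t) -> d <= degL t.

Lemma tight_probL_bounds x : 0 <= qL x <= d^-1.
Proof.
rewrite /tight_prob divr_ge0 ?ler0n ?deg_ge0 //=.
case Lx: (L x); last by rewrite mul0r invr_ge0 ltW.
have := L_size Lx; case/lastP: x Lx => // t v; rewrite size_rcons => Lx [st].
have Lvt : L (v :: t) by rewrite -Lrcons.
rewrite -cats1 take_size_cat // mul1r lef_pV2 ?posrE ?(L_deg Lvt) //.
exact: lt_le_trans (L_deg Lvt).
Qed.

Lemma tight_probL_neq0 x : qL x != 0 -> L x.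
Proof. by apply: contra_neqT => /negbTE; rewrite /tight_prob => ->; rewrite mul0r. Qed.

Lemma sum_tight_probL x : L x -> \sum_v qL (rcons (behead x) v) = 1.
Proof.
move=> Lx; have := L_size Lx; case: x Lx => // a t Lx [st] /=.
have dt : degL t != 0 by rewrite gt_eqF // (lt_le_trans d_gt0) // (L_deg Lx).
rewrite -(mulfV dt) [in RHS]/deg mulr_suml; apply: eq_bigr => v _.
by rewrite /tight_prob Lrcons -cats1 take_size_cat.
Qed.

(** The factor [L t] also forces the support into the link, where the transition probabilities sum
    to 1. *)
Definition link_bounded (B : R) psi := forall t, `|psi t| <= B * (L t)%:R.

Lemma link_bounded_supp B psi t : link_bounded B psi -> psi t != 0 -> L t.
Proof.
move=> pB; apply: contraNT => /negbTE Lt; have := pB t.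
by rewrite Lt mulr0 normr_le0.
Qed.

Lemma link_bounded_ge0 B psi t : link_bounded B psi -> L t -> 0 <= B.
Proof. by move=> pB Lt; have := pB t; rewrite Lt mulr1; apply: le_trans. Qed.

Lemma link_sum_bound B psi t : link_bounded B psi ->
  `|\sum_a psi (a :: t)| <= B * degL t.
Proof.
move=> pB; apply: le_trans (ler_norm_sum _ _ _) _; rewrite mulr_sumr.
by apply: ler_sum => a _.
Qed.

Lemma link_bounded_resample B psi : link_bounded B psi -> link_bounded B (resample psi).
Proof.
move=> pB t; rewrite /resample; case Lt: (L t); last by rewrite !(mul0r, mulr0) normr0.
have := L_size Lt; case: t Lt => // a t Lt _ /=.
have dt : 0 < degL t by apply: lt_le_trans (L_deg Lt).
rewrite mul1r mulr1 normrM ger0_norm ?invr_ge0 ?(ltW dt) // mulrC ler_pdivrMr //.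
exact: link_sum_bound.
Qed.

Lemma link_bounded_push B psi : link_bounded B psi -> link_bounded B (pushL psi).
Proof.
move=> pB t; rewrite /push /tight_prob; case Lt: (L t); last by rewrite !(mul0r, mulr0) normr0.
have := L_size Lt; case/lastP: t Lt => // t v Lx; rewrite size_rcons => -[st].
have Lvt : L (v :: t) by rewrite -Lrcons.
have dt : 0 < degL t by apply: lt_le_trans (L_deg Lvt).
rewrite -cats1 take_size_cat // mul1r mulr1 normrM ger0_norm ?invr_ge0 ?(ltW dt) //.
by rewrite mulrC ler_pdivrMr //; exact: link_sum_bound.
Qed.

Lemma link_bounded_iter_push B psi i : link_bounded B psi -> link_bounded B (iter i pushL psi).
Proof. by move=> pB; elim: i => //= i; exact: link_bounded_push. Qed.

Lemma link_bounded_spread B psi : link_bounded B psi ->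
  link_bounded (B * (2 * b.+2 ^ 2)%:R) (spread psi).
Proof.
move=> pB t; apply: le_trans (ler_normD _ _) _.
have [Lt|NLt] := boolP (L t); last first.
  have z phi : link_bounded B phi -> phi t = 0.
    by move=> /(_ t); rewrite (negbTE NLt) mulr0 normr_le0 => /eqP.
  rewrite z // big1 ?normr0 ?addr0 ?mulr0 // => i _.
  by rewrite !z ?subrr ?mulr0 //; [apply: link_bounded_resample|]; apply: link_bounded_iter_push.
have B0 := link_bounded_ge0 pB Lt.
apply: (@le_trans _ _ (B + \sum_(i < b.+1) b.+2%:R * (2 * B))).
  apply: lerD; first by have := pB t; rewrite Lt mulr1.
  apply: le_trans (ler_norm_sum _ _ _) _; apply: ler_sum => i _.
  rewrite normrM normr_nat; apply: ler_pM => //.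
    by rewrite ler_nat; have := ltn_ord i; lia.
  apply: le_trans (ler_normB _ _) _; rewrite mulr2n mulrDl mul1r.
  have pi := link_bounded_iter_push i pB.
  by apply: lerD; [have := pi t | have := link_bounded_resample pi t]; rewrite Lt mulr1.
rewrite sumr_const card_ord mulr1 -[_ *+ b.+1]mulr_natl.
have -> : B + b.+1%:R * (b.+2%:R * (2 * B)) = B * (1 + b.+1 * (b.+2 * 2))%:R.
  by rewrite natrD !natrM; ring.
by rewrite ler_wpM2l // ler_nat; lia.
Qed.

Lemma walk_weight_bound B psi z : link_bounded B psi -> 0 <= B -> size z = (b.+1 + b.+1)%N ->
  `|walk_weight psi z| <= B * (2 * b.+2 ^ 2)%:R * d^-1 ^+ b.+1.
Proof.
move=> pB B0 sz; rewrite normrM; apply: ler_pM => //.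
  apply: le_trans (link_bounded_spread pB _) _.
  by rewrite ler_piMr ?lern1 ?leq_b1 // mulr_ge0.
rewrite ger0_norm; last by apply: wprod_ge0 => x; case/andP: (tight_probL_bounds x).
apply: le_trans (wprod_le _ _ tight_probL_bounds) _.
by rewrite size_behead sz (_ : ((b.+1 + b.+1).-1 - b)%N = b.+1) //; lia.
Qed.

Lemma walk_weight_neq0 B psi z i : link_bounded B psi -> size z = (b.+1 + b.+1)%N ->
  walk_weight psi z != 0 -> (i <= b.+1)%N -> L (take b.+1 (drop i z)).
Proof.
move=> pB sz; rewrite mulf_eq0 negb_or.
move=> /andP[/(link_bounded_supp (link_bounded_spread pB)) L0 w0].
case: i => [|i] ib; first by rewrite drop0.
have ii : (i < size (behead z) - b)%N by rewrite size_behead sz; lia.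
by have := tight_probL_neq0 (wprod_neq0 ii w0); rewrite -drop1 drop_drop addn1.
Qed.

(* Write <m> for the sum of m Y. Since push kills psi - resample psi and
   <resample psi> = <push psi>, the k windows of a walk started from psi - resample psi
   contribute <psi> - <push psi> in total, while those of a walk started from psi contribute
   the sum of the <push^i psi>; the coefficients of [spread] make this telescope. *)
Lemma tsum_walk_weight B psi Y : link_bounded B psi ->
  (forall s t, perm_eq s t -> Y s = Y t) ->
  tsum (b.+1 + b.+1) (fun z => walk_weight psi z * \sum_(i < b.+2) Y (take b.+1 (drop i z)))
  = b.+2%:R * tsum b.+1 (fun t => psi t * Y t).
Proof.
move=> pB Y_perm.
pose br phi := tsum b.+1 (fun t => phi t * Y t).
pose T phi := \sum_(i < b.+2) br (iter i pushL phi).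
transitivity (T (spread psi)).
  transitivity (\sum_(i < b.+2) tsum (b.+1 + b.+1)
     (fun z => spread psi (take b.+1 z) * wprod b qL (behead z) * Y (take b.+1 (drop i z)))).
    by rewrite exchange_tsum; apply: eq_tsum => z _; rewrite mulr_sumr.
  apply: eq_bigr => i _; apply: (tsum_window (S := L)).
  - by move=> x _; exact: sum_tight_probL.
  - by move=> x _; exact: tight_probL_neq0.
  - by rewrite -ltnS.
  - by move=> x _; exact: link_bounded_supp (link_bounded_spread pB).
have br_lin a phi1 phi2 : br (fun t => a * phi1 t + phi2 t) = a * br phi1 + br phi2.
  by rewrite /br -tsumZ -tsumD; apply: eq_tsum => t _; ring.
have eq_br phi1 phi2 : phi1 =1 phi2 -> br phi1 = br phi2.
  by move=> e; apply: eq_tsum => t _; rewrite e.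
have T_lin a phi1 phi2 : T (fun t => a * phi1 t + phi2 t) = a * T phi1 + T phi2.
  rewrite /T mulr_sumr -big_split; apply: eq_bigr => i _ /=.
  by rewrite -br_lin; apply: eq_br => t; rewrite iter_push_lin.
have eq_T phi1 phi2 : phi1 =1 phi2 -> T phi1 = T phi2.
  move=> e; apply: eq_bigr => i _; apply: eq_br.
  by elim: (val i) => //= k IH t; exact: eq_push.
have T_res phi : T (fun t => phi t - resample phi t) = br phi - br (pushL phi).
  rewrite /T big_ord_recl big1 => [|i _]; last first.
    by apply: tsum_eq0 => t _; rewrite iter_push_resample mul0r.
  rewrite addr0 /br -(tsum_resample _ Y_perm) -tsumB; apply: eq_tsum => t _; exact: mulrBl.
have T_sum m : (m <= b.+1)%N -> T (fun t => psi t + \sum_(i < m) (b.+1 - i)%:R *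
      (iter i pushL psi t - resample (iter i pushL psi) t)) =
    T psi + \sum_(i < m) (b.+1 - i)%:R * (br (iter i pushL psi) - br (iter i.+1 pushL psi)).
  elim: m => [|m IH] mb.
    by rewrite big_ord0 addr0; apply: eq_T => t; rewrite big_ord0 addr0.
  rewrite big_ord_recr /= addrA -(IH (ltnW mb)) -T_res addrC -T_lin; apply: eq_T => t.
  by rewrite big_ord_recr /=; ring.
have -> : T (spread psi) = T psi + \sum_(i < b.+1) (b.+1 - i)%:R *
    (br (iter i pushL psi) - br (iter i.+1 pushL psi)) by exact: T_sum.
exact: (weighted_telescope (fun i => br (iter i pushL psi))).
Qed.

End LinkWalk.

(** * Swapping one vertex of a closed walk *)

Lemma window_cat (T : Type) j i (t s : seq T) : size t = j -> (i <= j)%N ->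
  take j (drop i (t ++ s)) = drop i t ++ take i s.
Proof.
move=> st; rewrite leq_eqVlt => /orP[/eqP ij|ij].
  by rewrite ij drop_size_cat // drop_oversize ?st.
rewrite drop_cat st ij take_cat size_drop st ltnNge leq_subr /=.
by rewrite subKn // ltnW.
Qed.

Lemma window_insert (T : Type) j i (t s : seq T) c : size t = j -> (i <= j)%N ->
  take j.+1 (drop i (t ++ c :: s)) = drop i t ++ c :: take i s.
Proof.
move=> st ij; rewrite -cat_rcons (@window_cat _ j.+1) ?size_rcons ?st ?leqW //.
by rewrite drop_rcons ?st // cat_rcons.
Qed.

Section Gadget.
Context (R : realFieldType) (V : finType).
Variables (b : nat) (E : seq V -> bool) (g : R).
Implicit Types (r : R) (s t u v w x y z : seq V) (f : seq V -> R) (m i : nat) (c d : V).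

Local Notation j := b.+1.
Local Notation n := (#|V|%:R : R).
Local Notation q := (tight_prob R j E).
Local Notation P := (next_mean q).
Local Notation N := (num_edges R j E).

Hypothesis E_perm : forall s t, perm_eq s t -> E s = E t.
Hypothesis E_uniq : forall s, E s -> uniq s.
Hypothesis E_size : forall s, E s -> size s = j.+1.
Hypothesis g_gt0 : 0 < g.
Hypothesis V_gt0 : 0 < n.
Hypothesis deg_ge : forall t, size t = j -> uniq t -> (1 + g) / 2 * n <= deg R E t.

Definition link c d t := E (c :: t) && E (d :: t).

(** The value of [f] at [rcons t c] is shared equally among the completions [d] of [t], so that
    exchanging [c] for [d] with this weight imitates one step of the walk; see
    [sum_tsum_swap_seed]. *)
Definition swap_seed f c d t : R := f (rcons t c) * (link c d t)%:R / deg R E t.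

Definition swap_walk f c d z : R := walk_weight b (link c d) (swap_seed f c d) z / b.+2%:R.

(** Net weight of [c] in the middle of [z]: exchanging [c] for [d] counts positively at [c] and
    negatively at [d]. *)
Definition swap_weight f z c : R := \sum_d (swap_walk f c d z - swap_walk f d c z).

(** Total weight of the return paths from [s] to [t] through [m] vertices. Dividing by it makes the
    return path of a gadget a probability distribution. *)
Definition closing m s t : R := tsum m (fun u => wprod j q (s ++ u ++ t)).

(* A closed walk is read as t ++ c :: s ++ u with |t| = |s| = j; the weight only depends on c
   through [swap_weight], which sums to 0 over c. *)
Definition gadget m f v : R :=
  if drop j v is c :: w then
    swap_weight f (take j v ++ take j w) c *
      (wprod j q (w ++ take j v) / closing m (take j w) (take j v))
  else 0.

Lemma closed_walk_split m v : size v = (j + (j + m).+1)%N ->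
  exists t c s u, [/\ v = t ++ c :: s ++ u, size t = j, size s = j & size u = m].
Proof.
move=> sv; have := cat_take_drop j v.
have : size (drop j v) = (j + m).+1 by rewrite size_drop sv addKn.
have : size (take j v) = j by rewrite size_takel // sv leq_addr.
case: (drop j v) => [//|c w] st [sw] vE; exists (take j v), c, (take j w), (drop j w).
by rewrite cat_take_drop vE st size_takel ?size_drop ?sw ?leq_addr ?addKn.
Qed.

Lemma gadgetE m f t c s u : size t = j -> size s = j ->
  gadget m f (t ++ c :: s ++ u) =
  swap_weight f (t ++ s) c * (wprod j q (s ++ u ++ t) / closing m s t).
Proof.
by move=> st ss; rewrite /gadget drop_size_cat // !take_size_cat // catA.
Qed.

Lemma link_perm c d s t : perm_eq s t -> link c d s = link c d t.
Proof. by move=> st; congr (_ && _); apply: E_perm; rewrite perm_cons. Qed.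

Lemma link_size c d t : link c d t -> size t = j.
Proof. by move=> /andP[/E_size [->]]. Qed.

(** Completing [t] in the common link means completing both [c :: t] and [d :: t] in [E], so
    [common_nbrs] applies. *)
Lemma link_deg c d a t : link c d (a :: t) -> g * n <= deg R (link c d) t.
Proof.
move=> /andP[Ec Ed].
have uniq_behead (x y : V) z : E [:: x, y & z] -> uniq (x :: z) /\ size (x :: z) = j.
  move=> Exyz; have [sz] := E_size Exyz; split; last by rewrite /= sz.
  by have := E_uniq Exyz; rewrite /= inE negb_or => /andP[/andP[_ ->] /andP[_ ->]].
have [uc sc] := uniq_behead _ _ _ Ec; have [ud sd] := uniq_behead _ _ _ Ed.
apply: le_trans (common_nbrs deg_ge sc uc sd ud) _.
apply: ler_sum => v _; rewrite /link.
have swap (x y : V) z : E [:: x, y & z] = E [:: y, x & z].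
  by apply: E_perm; rewrite (perm_catCA [:: x] [:: y] z).
by rewrite (swap c) (swap d).
Qed.

Lemma swap_seed_bounded f F c d : (forall x, E x -> `|f x| <= F) ->
  link_bounded (link c d) (F * (2 / n)) (swap_seed f c d).
Proof.
move=> fF t; rewrite /swap_seed.
case Lt: (link c d t); last by rewrite !(mulr0, mul0r) normr0.
have /andP[Ec _] := Lt.
rewrite !mulr1 normrM; apply: ler_pM => //.
  by apply: fF; rewrite (E_rcons E_perm).
have h := half_le_deg E_uniq E_size g_gt0 V_gt0 deg_ge Ec.
have d0 := E_deg_gt0 E_uniq E_size g_gt0 V_gt0 deg_ge Ec.
rewrite ger0_norm ?invr_ge0 ?(ltW d0) // -invf_div.
by rewrite lef_pV2 ?posrE // divr_gt0.
Qed.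

Lemma swap_seed_lin r f1 f2 c d t :
  swap_seed (fun x => r * f1 x + f2 x) c d t = r * swap_seed f1 c d t + swap_seed f2 c d t.
Proof. by rewrite /swap_seed; ring. Qed.

Lemma eq_walk_weight (L : seq V -> bool) (phi psi : seq V -> R) z : phi =1 psi ->
  walk_weight b L phi z = walk_weight b L psi z.
Proof. by move=> /boolp.funext ->. Qed.

Lemma swap_walk_lin r f1 f2 c d z :
  swap_walk (fun x => r * f1 x + f2 x) c d z = r * swap_walk f1 c d z + swap_walk f2 c d z.
Proof.
rewrite /swap_walk (eq_walk_weight _ _ (swap_seed_lin _ _ _ _ _)) walk_weight_lin.
by rewrite mulrDl mulrA.
Qed.

Lemma gadget_lin m r f1 f2 v :
  gadget m (fun x => r * f1 x + f2 x) v = r * gadget m f1 v + gadget m f2 v.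
Proof.
rewrite /gadget; case: (drop j v) => [|c w]; first by rewrite mulr0 addr0.
have -> z : swap_weight (fun x => r * f1 x + f2 x) z c =
    r * swap_weight f1 z c + swap_weight f2 z c.
  rewrite /swap_weight mulr_sumr -big_split; apply: eq_bigr => d _ /=.
  by rewrite !swap_walk_lin; ring.
by rewrite mulrDl -mulrA.
Qed.

Lemma sum_swap_weight f z : \sum_c swap_weight f z c = 0.
Proof.
rewrite /swap_weight; under eq_bigr do rewrite sumrB.
by rewrite sumrB [X in _ - X]exchange_big subrr.
Qed.

(** The seed contributes [2 / n], the spreading [2 * b.+2 ^ 2] divided by the [b.+2] windows, and
    each of the [j] steps in the link at most [(g * n)^-1]. *)
Definition swap_bound : R := 2 / n * (2 * b.+2)%:R * (g * n)^-1 ^+ j.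

Lemma swap_walk_bound f F c d z : (forall x, E x -> `|f x| <= F) -> 0 <= F ->
  size z = (j + j)%N -> `|swap_walk f c d z| <= F * swap_bound.
Proof.
move=> fF F0 sz.
have gn : 0 < g * n by rewrite mulr_gt0.
have := walk_weight_bound (link_perm c d) gn (@link_size c d)
  (@link_deg c d) (swap_seed_bounded c d fF) _ sz.
rewrite mulr_ge0 ?divr_ge0 ?(ltW V_gt0) // => /(_ isT).
move=> h; rewrite /swap_walk normrM normfV normr_nat ler_pdivrMr ?ltr0n //.
apply: le_trans h _; rewrite le_eqVlt; apply/orP; left; apply/eqP.
rewrite /swap_bound -[(2 * b.+2 ^ 2)%N]/(2 * (b.+2 * b.+2))%N !natrM.
by ring.
Qed.

Lemma swap_walk_link f F c d z i : (forall x, E x -> `|f x| <= F) ->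
  size z = (j + j)%N -> swap_walk f c d z != 0 -> (i <= j)%N ->
  link c d (take j (drop i z)).
Proof.
move=> fF sz; rewrite mulf_eq0 negb_or => /andP[w0 _].
apply: (walk_weight_neq0 (link_perm c d) _ (@link_size c d) (@link_deg c d)
  (swap_seed_bounded c d fF)) => //.
by rewrite mulr_gt0.
Qed.

Lemma swap_weight_bound f F c z : (forall x, E x -> `|f x| <= F) -> 0 <= F ->
  size z = (j + j)%N -> `|swap_weight f z c| <= n * (2 * (F * swap_bound)).
Proof.
move=> fF F0 sz; apply: le_trans (ler_norm_sum _ _ _) _.
rewrite mulr_natl -sumr_const; apply: ler_sum => d _.
apply: le_trans (ler_normB _ _) _; rewrite mulr2n mulrDl mul1r.
by apply: lerD; apply: swap_walk_bound.
Qed.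

Lemma swap_weight_neq0 f F c z i : (forall x, E x -> `|f x| <= F) ->
  size z = (j + j)%N -> swap_weight f z c != 0 -> (i <= j)%N ->
  E (c :: take j (drop i z)).
Proof.
move=> fF sz w0 ij.
have /existsP[d] : [exists d, swap_walk f c d z - swap_walk f d c z != 0].
  apply: contraR w0; rewrite negb_exists => /forallP h.
  by apply/eqP; apply: big1 => d _; apply/eqP; have := h d; rewrite negbK.
have [->|n0 _] := eqVneq (swap_walk f c d z) 0.
  rewrite sub0r oppr_eq0 => /(swap_walk_link fF sz)/(_ ij).
  by case/andP.
by have /andP[] := swap_walk_link fF sz n0 ij.
Qed.

Variable m : nat.
Hypothesis mix : forall x y, E x -> E y ->
  (2 * N)^-1 <= iter (m + j.+1) P (fun z => (z == x)%:R) y.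

(** A walk from [c :: s] to [rcons t c] is a return path followed by one step of probability at most
    2/n; [mix] bounds the probability of the whole from below. *)
Lemma closing_bound c s t : E (c :: t) -> E (c :: s) -> n / (4 * N) <= closing m s t.
Proof.
move=> Ect Ecs; have Etc : E (rcons t c) by rewrite (E_rcons E_perm).
have [st] := E_size Ect; have [ss] := E_size Ecs.
have N0 : 0 < N := num_edges_gt0 R E_size Ect.
have := mix Etc Ecs; rewrite iter_next_mean_delta ?E_size //.
have -> : tsum m (fun u => wprod j q (behead (c :: s) ++ u ++ rcons t c)) =
    closing m s t * q (rcons t c).
  rewrite /closing mulrC -tsumZ; apply: eq_tsum => u _ /=.
  rewrite -cats1 catA wprod_cat // -catA mulrC; congr (_ * _).
  by rewrite wprod_window // size_cat st addn1.
rewrite (tight_prob_rcons R E_perm) // Ect mul1r.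
have d0 := E_deg_gt0 E_uniq E_size g_gt0 V_gt0 deg_ge Ect.
have h := half_le_deg E_uniq E_size g_gt0 V_gt0 deg_ge Ect.
rewrite ler_pdivlMr //; apply: le_trans.
have -> : n / (4 * N) = (2 * N)^-1 * (n / 2) by field; rewrite gt_eqF.
by rewrite ler_wpM2l // invr_ge0 mulr_ge0 // ltW.
Qed.

Let N_pos x : E x -> 0 < N.
Proof. exact: num_edges_gt0. Qed.

Lemma gadget_closing_neq0 f F c s t : (forall x, E x -> `|f x| <= F) ->
  size s = j -> size t = j ->
  swap_weight f (t ++ s) c != 0 -> n / (4 * N) <= closing m s t.
Proof.
move=> fF ss st w0.
have sz : size (t ++ s) = (j + j)%N by rewrite size_cat ss st.
apply: (@closing_bound c).
  by have := swap_weight_neq0 fF sz w0 (leq0n _); rewrite drop0 take_size_cat.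
have := swap_weight_neq0 fF sz w0 (leqnn _).
by rewrite drop_size_cat // take_oversize // ss.
Qed.

(** 32 = 2 * 4 * 4: the two signs in [swap_weight], the numerical factors of [swap_bound], and
    [closing_bound]. *)
Definition gadget_cost : R := (32 * b.+2)%:R / g ^+ j.

(** Where the gadget is nonzero, the [j.+1] windows through [c] are edges, so their probabilities
    multiply to at least [n^-1 ^+ j.+1]. This matches the size of [swap_bound], and the return path
    occurs on both sides; no power of n and no dependence on [m] survive. *)
Lemma gadget_bound f F v : (forall x, E x -> `|f x| <= F) -> 0 <= F ->
  size v = (j + (j + m).+1)%N ->
  `|gadget m f v| <= gadget_cost * F * (N * closed_wprod j q v).
Proof.
move=> fF F0 sv.
have q0 x : 0 <= q x by exact: tight_prob_ge0.
have w0 x : 0 <= wprod j q x by exact: wprod_ge0.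
have cost0 : 0 <= gadget_cost by rewrite divr_ge0 ?ler0n ?exprn_ge0 // ltW.
have N0 : 0 <= N by apply: tsum_ge0 => x _; exact: ler0n.
have [t [c [s [u [-> st ss su]]]]] := closed_walk_split sv.
rewrite gadgetE // /closed_wprod take_size_cat //.
have -> : wprod j q ((t ++ c :: s ++ u) ++ t) = wprod j q (t ++ c :: s) * wprod j q (s ++ u ++ t).
  by rewrite -cat_rcons -!catA wprod_cat // cat_rcons.
have [->|sn0] := eqVneq (swap_weight f (t ++ s) c) 0.
  by rewrite mul0r normr0; do !apply: mulr_ge0 => //.
have sz : size (t ++ s) = (j + j)%N by rewrite size_cat ss st.
have Ec i := swap_weight_neq0 (i := i) fF sz sn0.
have hZ := gadget_closing_neq0 fF ss st sn0.
have Npos : 0 < N := num_edges_gt0 R E_size (Ec 0 isT).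
have Z0 : 0 < closing m s t by apply: lt_le_trans hZ; rewrite divr_gt0 // mulr_gt0.
have hw : n^-1 ^+ j.+1 <= wprod j q (t ++ c :: s).
  have -> : j.+1 = (size (t ++ c :: s) - j)%N by rewrite size_cat /= st ss addKn.
  apply: wprod_ge; first by rewrite invr_ge0 ltW.
  move=> i; rewrite size_cat /= st ss addKn ltnS => ij.
  have := Ec i ij; rewrite window_insert // window_cat // => Ec'.
  have : E (drop i t ++ c :: take i s).
    by rewrite -(E_perm (s := c :: drop i t ++ take i s)) // -cat1s perm_catCA.
  by move=> /(tight_prob_bounds E_perm E_uniq E_size g_gt0 V_gt0 deg_ge)/andP[].
rewrite normrM [X in _ * X]ger0_norm ?divr_ge0 ?(ltW Z0) //.
apply: (@le_trans _ _ (n * (2 * (F * swap_bound)) * (wprod j q (s ++ u ++ t) * (4 * N / n)))).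
  apply: ler_pM; rewrite ?swap_weight_bound ?divr_ge0 ?(ltW Z0) //.
  rewrite ler_wpM2l // -invf_div lef_pV2 ?posrE //.
  by rewrite divr_gt0 // mulr_gt0.
have -> : n * (2 * (F * swap_bound)) * (wprod j q (s ++ u ++ t) * (4 * N / n)) =
    gadget_cost * F * (N * (n^-1 ^+ j.+1 * wprod j q (s ++ u ++ t))).
  rewrite /swap_bound /gadget_cost [n^-1 ^+ _]exprS !exprVn exprMn !natrM.
  have : g ^+ j != 0 by rewrite expf_neq0 // gt_eqF.
  have : n ^+ j != 0 by rewrite expf_neq0 // gt_eqF.
  have : n != 0 by rewrite gt_eqF.
  move: n (n ^+ j) (g ^+ j) (wprod _ _ _) (num_edges _ _ _) (b.+2%:R : R) => x y z w r p.
  by move=> x0 y0 z0; field; rewrite x0 y0 z0.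
by apply: ler_wpM2l; [exact: mulr_ge0 | apply: ler_wpM2l => //; exact: ler_wpM2r].
Qed.

Lemma tsum_closed_split (G : seq V -> R) : tsum (j + (j + m).+1) G =
  tsum j (fun t => \sum_c tsum j (fun s => tsum m (fun u => G (t ++ c :: s ++ u)))).
Proof.
rewrite tsum_cat; apply: eq_tsum => t _; rewrite tsumS; apply: eq_bigr => c _.
exact: tsum_cat.
Qed.

Variables (f Y : seq V -> R) (F : R).
Hypothesis f_le : forall x, E x -> `|f x| <= F.
Hypothesis Y_perm : forall s t, perm_eq s t -> Y s = Y t.

(** These windows contain [c] and do not meet [u], so summing over the return path cancels
    [closing]. *)
Lemma gadget_boundary_le i : (i <= j)%N ->
  tsum (j + (j + m).+1) (fun v => gadget m f v * Y (take j.+1 (rot i v))) =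
  tsum (j + j) (fun z => \sum_c swap_weight f z c * Y (c :: take j (drop i z))).
Proof.
move=> ij; rewrite tsum_closed_split tsum_cat; apply: eq_tsum => t st.
rewrite -exchange_tsum; apply: eq_bigr => c _; apply: eq_tsum => s ss.
rewrite window_cat //.
transitivity (tsum m (fun u => swap_weight f (t ++ s) c * Y (c :: drop i t ++ take i s) /
    closing m s t * wprod j q (s ++ u ++ t))).
  apply: eq_tsum => u su; rewrite gadgetE //.
  have -> : Y (take j.+1 (rot i (t ++ c :: s ++ u))) = Y (c :: drop i t ++ take i s).
    rewrite /rot takel_cat; last first.
      by rewrite size_drop !size_cat /= size_cat st ss su -addnBAC // addnS ltnS addnA -addnA
         addnCA leq_addr.
    rewrite window_insert // takel_cat ?ss //; apply: Y_perm.
    by rewrite -[c :: take i s]cat1s perm_catCA.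
  by ring.
rewrite tsumZ -/(closing m s t).
have [->|w0] := eqVneq (swap_weight f (t ++ s) c) 0; first by rewrite !mul0r.
rewrite divfK //; have := gadget_closing_neq0 f_le ss st w0.
have /N_pos : E (c :: take j (drop 0 (t ++ s))).
  by apply: (swap_weight_neq0 f_le) w0 _ => //; rewrite size_cat st ss.
by move=> N0; apply: contraTneq => ->; rewrite -ltNge divr_gt0 // mulr_gt0.
Qed.

(** These windows avoid [c], so only [swap_weight] depends on [c], and it sums to 0. *)
Lemma gadget_boundary_gt i : (j < i < j + (j + m).+1)%N ->
  tsum (j + (j + m).+1) (fun v => gadget m f v * Y (take j.+1 (rot i v))) = 0.
Proof.
move=> /andP[ji il]; rewrite tsum_cat; apply: tsum_eq0 => t st.
rewrite tsumS exchange_tsum; apply: tsum_eq0 => w sw.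
transitivity (\sum_c swap_weight f (t ++ take j w) c *
    (wprod j q (w ++ t) / closing m (take j w) t * Y (take j.+1 (drop (i - j.+1) w ++ t)))).
  apply: eq_bigr => c _; rewrite /gadget drop_size_cat // take_size_cat // -mulrA.
  congr (_ * (_ * Y _)).
  have [p ip] : exists p, i = (j.+1 + p)%N by exists (i - j.+1)%N; rewrite subnKC.
  have pw : (p < size w)%N by rewrite sw; move: il; rewrite ip addSn -addnS ltn_add2l ltnS.
  rewrite ip addKn /rot -cat_rcons drop_cat [take (j.+1 + p) _]take_cat size_rcons st.
  have /negbTE -> : ~~ (j.+1 + p < j.+1)%N by rewrite -leqNgt leq_addr.
  rewrite addKn cat_rcons catA takel_cat // size_cat st size_drop -add1n leq_add2r.
  by rewrite subn_gt0.
by rewrite -mulr_suml sum_swap_weight mul0r.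
Qed.

Lemma tsum_swap_walk c d :
  tsum (j + j) (fun z => swap_walk f c d z *
    \sum_(i < j.+1) (Y (c :: take j (drop i z)) - Y (d :: take j (drop i z)))) =
  tsum j (fun t => swap_seed f c d t * (Y (c :: t) - Y (d :: t))).
Proof.
have gn : 0 < g * n by rewrite mulr_gt0.
have Ycd s t : perm_eq s t -> Y (c :: s) - Y (d :: s) = Y (c :: t) - Y (d :: t).
  by move=> st; congr (_ - _); apply: Y_perm; rewrite perm_cons.
rewrite -[RHS](mulKf (x := b.+2%:R)) ?pnatr_eq0 //.
rewrite -(tsum_walk_weight (link_perm c d) gn (@link_size c d) (@link_deg c d)
  (swap_seed_bounded c d f_le) Ycd).
by rewrite -tsumZ; apply: eq_tsum => z _; rewrite /swap_walk; ring.
Qed.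

(** In the first term the sum over [d] cancels the degree and leaves [f]; in the second the sum over
    [c] is the mean of [f] after one step from [d :: t]. *)
Lemma sum_tsum_swap_seed :
  \sum_c \sum_d tsum j (fun t => swap_seed f c d t * (Y (c :: t) - Y (d :: t))) =
  tsum j.+1 (fun x => (E x)%:R * ((f x - P f x) * Y x)).
Proof.
transitivity (tsum j.+1 (fun x => (E x)%:R * f x * Y x) -
  tsum j.+1 (fun x => (E x)%:R * P f x * Y x)); last first.
  by rewrite -tsumB; apply: eq_tsum => x _; ring.
under eq_bigr do rewrite exchange_tsum.
rewrite exchange_tsum [X in _ = X - _]tsumSr [X in _ = _ - X]tsumS exchange_tsum -tsumB.
apply: eq_tsum => t st.
transitivity (\sum_c \sum_d swap_seed f c d t * Y (c :: t) -
  \sum_c \sum_d swap_seed f c d t * Y (d :: t)).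
  rewrite -sumrB; apply: eq_bigr => c _; rewrite -sumrB; apply: eq_bigr => d _.
  exact: mulrBr.
have seedE c d : swap_seed f c d t =
    (E (d :: t))%:R / deg R E t * ((E (c :: t))%:R * f (rcons t c)).
  by rewrite /swap_seed /link; case: (E (c :: t)); case: (E (d :: t)) => /=; ring.
congr (_ - _).
  apply: eq_bigr => c _; rewrite (E_rcons E_perm).
  have -> : Y (rcons t c) = Y (c :: t) by apply: Y_perm; rewrite perm_rcons.
  under eq_bigr do rewrite seedE -mulrA.
  rewrite -mulr_suml -mulr_suml -/(deg R E t).
  case Ect: (E (c :: t)); last by rewrite !(mul0r, mulr0).
  by rewrite mulVKf // gt_eqF // (E_deg_gt0 E_uniq E_size g_gt0 V_gt0 deg_ge Ect).
rewrite exchange_big; apply: eq_bigr => d _; rewrite -mulr_suml; congr (_ * _).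
rewrite /next_mean mulr_sumr; apply: eq_bigr => c _.
by rewrite seedE (tight_prob_rcons R E_perm) //; ring.
Qed.

Lemma gadget_boundary :
  \sum_(i < j + (j + m).+1)
    tsum (j + (j + m).+1) (fun v => gadget m f v * Y (take j.+1 (rot i v))) =
  tsum j.+1 (fun x => (E x)%:R * ((f x - P f x) * Y x)).
Proof.
pose B i := tsum (j + (j + m).+1) (fun v => gadget m f v * Y (take j.+1 (rot i v))).
rewrite -(big_mkord xpredT B) (@big_cat_nat _ _ _ j.+1) //=; last by rewrite addnS ltnS leq_addr.
rewrite [X in _ + X]big_nat [X in _ + X]big1 ?addr0 => [|i il]; last exact: gadget_boundary_gt.
rewrite big_mkord.
transitivity (\sum_(i < j.+1)
    tsum (j + j) (fun z => \sum_c swap_weight f z c * Y (c :: take j (drop i z)))).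
  by apply: eq_bigr => i _; apply: gadget_boundary_le; rewrite -ltnS.
rewrite exchange_tsum -sum_tsum_swap_seed.
under [RHS]eq_bigr do under eq_bigr do rewrite -tsum_swap_walk.
under [RHS]eq_bigr do rewrite exchange_tsum.
rewrite exchange_tsum; apply: eq_tsum => z _; rewrite exchange_big /=.
pose S c := \sum_(i < j.+1) Y (c :: take j (drop i z)).
transitivity (\sum_c \sum_d (swap_walk f c d z - swap_walk f d c z) * S c).
  by apply: eq_bigr => c _; rewrite -mulr_sumr /swap_weight mulr_suml.
transitivity (\sum_c \sum_d swap_walk f c d z * S c - \sum_c \sum_d swap_walk f d c z * S c).
  rewrite -sumrB; apply: eq_bigr => c _; rewrite -sumrB; apply: eq_bigr => d _.
  exact: mulrBl.
(* Renaming [c] and [d] in the second sum gives every swap the factor [S c - S d]. *)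
rewrite [X in _ - X]exchange_big -sumrB; apply: eq_bigr => c _.
rewrite -sumrB; apply: eq_bigr => d _; by rewrite sumrB mulrBr.
Qed.

End Gadget.

(** * Exact weights on injective closed walks *)

Lemma uniq_linear_surjective (R : realFieldType) (T : finType) (D : pred T)
    (A : (T -> R) -> T -> R) :
  (forall r f1 f2 x, A (fun y => r * f1 y + f2 y) x = r * A f1 x + A f2 x) ->
  (forall f, (forall x, D x -> A f x = 0) -> forall x, D x -> f x = 0) ->
  forall e : T -> R, exists f, forall x, D x -> A f x = e x.
Proof.
move=> A_lin A_inj e.
have A0 x : A (fun=> 0) x = 0.
  have := A_lin 1 (fun=> 0) (fun=> 0) x.
  rewrite (_ : (fun=> 1 * 0 + 0) = fun=> 0); last by apply/boolp.funext => y; rewrite mulr0 addr0.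
  by rewrite mul1r => /eqP; rewrite -subr_eq subrr => /eqP.
have A_sum I (r : seq I) (c : I -> R) (F : I -> T -> R) x :
    A (fun y => \sum_(i <- r) c i * F i y) x = \sum_(i <- r) c i * A (F i) x.
  elim: r => [|i r IH].
    by rewrite big_nil -[RHS](A0 x); congr (A _ x); apply/boolp.funext => y; rewrite big_nil.
  rewrite big_cons -IH -A_lin; congr (A _ x); apply/boolp.funext => y; exact: big_cons.
(* Acting as the identity off [D] turns injectivity on [D] into injectivity of a square matrix
   indexed by all of [T]. *)
pose cut (f : T -> R) y := if D y then f y else 0.
pose B f x := if D x then A (cut f) x else f x.
have B_sum I (r : seq I) (c : I -> R) (F : I -> T -> R) x :
    B (fun y => \sum_(i <- r) c i * F i y) x = \sum_(i <- r) c i * B (F i) x.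
  rewrite /B; case: ifP => // _; rewrite -A_sum; congr (A _ x); apply/boolp.funext => y.
  by rewrite /cut; case: (D y) => //; rewrite big1 // => i _; rewrite mulr0.
pose M : 'M[R]_#|T| :=
  \matrix_(i, j) B (fun y => (y == enum_val i)%:R) (enum_val j).
have mulM (u : 'rV_#|T|) j : (u *m M) 0 j = B (fun y => u 0 (enum_rank y)) (enum_val j).
  rewrite mxE; under eq_bigr do rewrite mxE.
  rewrite -B_sum; congr (B _ _); apply/boolp.funext => y.
  rewrite (bigD1 (enum_rank y)) //= enum_rankK eqxx mulr1 big1 ?addr0 // => i.
  by apply: contraNeq; rewrite mulf_eq0 negb_or pnatr_eq0 eqb0 negbK => /andP[_ /eqP ->];
    rewrite enum_valK.
have M_unit : M \in unitmx.
  rewrite -row_free_unit; apply: inj_row_free => u uM.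
  have Bu y : B (fun y => u 0 (enum_rank y)) y = 0.
    by rewrite -[y]enum_rankK -mulM uM mxE.
  have cut0 x : D x -> cut (fun y => u 0 (enum_rank y)) x = 0.
    by apply: A_inj => y Dy; have := Bu y; rewrite /B Dy.
  apply/rowP => i; rewrite mxE -[i]enum_valK.
  have [Di|NDi] := boolP (D (enum_val i)).
    by have := cut0 _ Di; rewrite /cut Di.
  by have := Bu (enum_val i); rewrite /B (negbTE NDi).
pose u := (\row_i e (enum_val i)) *m invmx M.
exists (cut (fun y => u 0 (enum_rank y))) => x Dx.
have := mulM u (enum_rank x); rewrite mulmxKV // mxE enum_rankK /B Dx; exact: esym.
Qed.

Section Counting.
Context (R : realFieldType) (V : finType).
Implicit Types (s t u v x y : seq V).
Local Notation n := (#|V|%:R : R).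

Lemma sum_mem_le s : \sum_(v : V) (v \in s)%:R <= (size s)%:R :> R.
Proof.
rewrite -natr_sum ler_nat (leq_trans _ (card_size s)) // -sum1_card [leqRHS]big_mkcond.
by apply: leq_sum => v _; case: (v \in s).
Qed.

(** Union bound over the appended vertices: each has fewer than [size x + m] earlier vertices to
    repeat. *)
Lemma nonuniq_count m x : 0 < n -> uniq x ->
  tsum m (fun u => (~~ uniq (x ++ u))%:R) <= (m * (size x + m))%:R * n ^+ m / n.
Proof.
move=> n0 ux; elim: m => [|m IH]; first by rewrite tsum0 cats0 ux mul0n !mul0r.
rewrite tsumSr.
apply: (@le_trans _ _ (tsum m (fun u => n * (~~ uniq (x ++ u))%:R + (size x + m)%:R))).
  apply: ler_tsum => u su.
  apply: (@le_trans _ _ (\sum_(v : V) ((~~ uniq (x ++ u))%:R + (v \in x ++ u)%:R))).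
    apply: ler_sum => v _; rewrite -rcons_cat rcons_uniq negb_and negbK -natrD ler_nat addnC.
    by case: (_ \in _); case: (uniq _).
  rewrite big_split sumr_const /= mulr_natl lerD2l.
  by apply: le_trans (sum_mem_le _) _; rewrite size_cat su.
rewrite tsumD tsumZ tsum_const -[_ *+ (_ ^ _)]mulr_natr natrX.
apply: (@le_trans _ _ (n * ((m * (size x + m))%:R * n ^+ m / n) + (size x + m)%:R * n ^+ m)).
  by rewrite lerD2r ler_wpM2l // ltW.
have -> : n * ((m * (size x + m))%:R * n ^+ m / n) + (size x + m)%:R * n ^+ m =
    (m.+1 * (size x + m))%:R * n ^+ m.
  by rewrite mulSn natrD; field; rewrite gt_eqF.
have -> : (m.+1 * (size x + m.+1))%:R * n ^+ m.+1 / n = (m.+1 * (size x + m.+1))%:R * n ^+ m.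
  by rewrite exprS; field; rewrite gt_eqF.
by rewrite ler_wpM2r ?exprn_ge0 ?(ltW n0) // ler_nat leq_mul2l leq_add2l leqnSn orbT.
Qed.

Lemma tsum_perm_eq x : uniq x ->
  tsum (size x) (fun y => (perm_eq x y)%:R) = (size x)`!%:R :> R.
Proof.
move=> ux; rewrite -size_permutations // /tsum -natr_sum; congr _%:R.
transitivity #|[pred y : (size x).-tuple V | perm_eq x y]|.
  by rewrite -sum1_card [RHS]big_mkcond; apply: eq_bigr => y _; rewrite inE; case: perm_eq.
rewrite cardE -(size_map val).
apply/perm_size/uniq_perm; rewrite ?permutations_uniq ?(map_inj_uniq val_inj) ?enum_uniq //.
move=> y; rewrite mem_permutations; apply/mapP/idP => [[t + ->]|yx].
  by rewrite mem_enum inE perm_sym.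
exists (tcast (perm_size yx) (in_tuple y)); last by rewrite [RHS]val_tcast.
by rewrite mem_enum inE val_tcast /= perm_sym.
Qed.

End Counting.

Section ClosedWalks.
Context (R : realFieldType) (V : finType).
Variables (j m : nat) (q : seq V -> R).
Implicit Types (s t u v x y : seq V).
Local Notation n := (#|V|%:R : R).

Lemma closed_wprod_cat x u : size x = j.+1 ->
  closed_wprod j q (x ++ u) = q x * wprod j q (behead x ++ u ++ take j x).
Proof.
move=> sx; rewrite /closed_wprod takel_cat ?sx // -catA.
case: x sx => // a t [st]; rewrite cat_cons wprod_cons ?size_cat ?st ?leq_addr //.
by congr (q _ * _); rewrite -cat_cons take_size_cat //= st.
Qed.

(** The factor of the window [x] moves from the start to the end, so that closed walks through [x]
    become returns of the walk to [x]. *)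
Lemma closed_wprod_return x u : size x = j.+1 ->
  closed_wprod j q (x ++ u) = wprod j q (behead x ++ u ++ x).
Proof.
move=> sx; rewrite closed_wprod_cat //.
rewrite -[X in _ = wprod _ _ (_ ++ _ ++ X)](cat_take_drop j x) [in RHS]catA.
by rewrite [RHS]wprod_cat ?size_takel ?sx // cat_take_drop (wprod_window q sx) mulrC catA.
Qed.

Lemma tsum_closed_wprod i (G Y : seq V -> R) :
  (forall v, size v = (j.+1 + m)%N -> G (rot i v) = G v) ->
  tsum (j.+1 + m) (fun v => G v * closed_wprod j q v * Y (take j.+1 (rot i v))) =
  tsum j.+1 (fun x => Y x * tsum m (fun u => G (x ++ u) * closed_wprod j q (x ++ u))).
Proof.
move=> G_rot.
transitivity (tsum (j.+1 + m) (fun v => G v * closed_wprod j q v * Y (take j.+1 v))).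
  rewrite -[RHS](tsum_rot _ i); apply: eq_tsum => v sv.
  by rewrite G_rot // closed_wprod_rot ?sv ?leq_addr.
rewrite tsum_cat; apply: eq_tsum => x sx; rewrite -tsumZ; apply: eq_tsum => u _.
by rewrite take_size_cat // mulrC.
Qed.

End ClosedWalks.

(** * Correcting the covering exactly by solving a perturbed linear system *)

Section Assembly.
Context (R : realFieldType) (V : finType).
Variables (b : nat) (E : seq V -> bool) (g : R) (m : nat).
Implicit Types (s t u v x y z : seq V) (f h G W : seq V -> R) (i : nat) (B F r : R).

Local Notation j := b.+1.
Local Notation n := (#|V|%:R : R).
Local Notation q := (tight_prob R j E).
Local Notation P := (next_mean q).
Local Notation N := (num_edges R j E).
Local Notation J := (edge_mean j E).
Local Notation l := (j + (j + m).+1)%N.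
Local Notation K := (gadget_cost b g).
Local Notation K0 := (1 + (4 * j.+1)%:R / g ^+ j.+1).

Hypothesis E_perm : forall s t, perm_eq s t -> E s = E t.
Hypothesis E_uniq : forall s, E s -> uniq s.
Hypothesis E_size : forall s, E s -> size s = j.+1.
Hypothesis g_gt0 : 0 < g.
Hypothesis V_gt0 : 0 < n.
Hypothesis deg_ge : forall t, size t = j -> uniq t -> (1 + g) / 2 * n <= deg R E t.

Let qP x : 0 <= q x <= 2 / n.
Proof. by rewrite tight_prob_ge0 (tight_prob_le E_perm E_uniq E_size g_gt0). Qed.

Let w0 x : 0 <= wprod j q x.
Proof. by apply: wprod_ge0 => y; case/andP: (qP y). Qed.

Let lE : l = (j.+1 + (j + m))%N. Proof. by rewrite addnS. Qed.

(** How much the closed walks weighted by [W] cover the edge underlying [x]: windows are compared up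
    to order, and every position of the walk counts. *)
Definition boundary W x : R :=
  \sum_(i < l) tsum l (fun v => W v * (perm_eq x (take j.+1 (rot i v)))%:R).

Definition sum_orders f x : R := tsum j.+1 (fun y => (perm_eq x y)%:R * f y).

(** By stationarity [f - P f] has mean 0, so gadgets cannot change the total covering; the term
    [J f] restores the missing direction. *)
Definition drift f x : R := f x - P f x + J f.

(** The gadgets supply [f - P f], and a multiple of the natural closed walks supplies the constant
    [J f]; with the factor [N / l] these cover every ordered edge about once. *)
Definition tilt f v : R := J f * (N / l%:R) * closed_wprod j q v + gadget b E m f v.

Definition injective_tilt f v : R := (uniq v)%:R * tilt f v.

(** A transition probability may be twice the uniform 1/n, which over [l] steps gives [2 ^+ l];
    there are at most [l ^ 2] pairs of positions, and each coincidence costs 1/n. *)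
Definition collision_rate : R := 2 ^+ l * (l ^ 2)%:R / n.

Let perm_ind x s t : perm_eq s t -> (perm_eq x s)%:R = (perm_eq x t)%:R :> R.
Proof. by move=> st; rewrite (permPr st). Qed.

Lemma boundaryD W1 W2 x : boundary (fun v => W1 v + W2 v) x = boundary W1 x + boundary W2 x.
Proof.
by rewrite /boundary -big_split; apply: eq_bigr => i _ /=; rewrite -tsumD;
  apply: eq_tsum => v _; rewrite mulrDl.
Qed.

Lemma boundaryZ r W x : boundary (fun v => r * W v) x = r * boundary W x.
Proof.
by rewrite /boundary mulr_sumr; apply: eq_bigr => i _; rewrite -tsumZ;
  apply: eq_tsum => v _; rewrite mulrA.
Qed.

Lemma eq_boundary W1 W2 x : (forall v, size v = l -> W1 v = W2 v) ->
  boundary W1 x = boundary W2 x.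
Proof. by move=> e; apply: eq_bigr => i _; apply: eq_tsum => v /e ->. Qed.

Lemma boundary_norm W1 W2 x : (forall v, size v = l -> `|W1 v| <= W2 v) ->
  `|boundary W1 x| <= boundary W2 x.
Proof.
move=> W12; apply: le_trans (ler_norm_sum _ _ _) _; apply: ler_sum => i _.
apply: le_trans (ler_norm_tsum _ _) _; apply: ler_tsum => v sv.
by rewrite normrM normr_nat ler_wpM2r // W12.
Qed.

Lemma tsum_closed_walks i G f : (forall v, G (rot i v) = G v) ->
  tsum l (fun v => G v * closed_wprod j q v * f (take j.+1 (rot i v))) =
  tsum j.+1 (fun x => f x * tsum (j + m) (fun u => G (x ++ u) * closed_wprod j q (x ++ u))).
Proof. by move=> G_rot; rewrite lE; apply: tsum_closed_wprod. Qed.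

Lemma boundary_closed x :
  boundary (closed_wprod j q) x =
  l%:R * sum_orders (fun y => iter l P (fun z => (z == y)%:R) y) x.
Proof.
rewrite /boundary mulr_natl -[X in _ *+ X]card_ord -sumr_const; apply: eq_bigr => i _.
transitivity (tsum l (fun v => (fun=> 1) v * closed_wprod j q v *
    (perm_eq x (take j.+1 (rot i v)))%:R)).
  by apply: eq_tsum => v _; rewrite mul1r.
rewrite (@tsum_closed_walks i (fun=> 1) (fun s => (perm_eq x s)%:R)) //; apply: eq_tsum => y sy.
congr (_ * _); rewrite lE (addnC j.+1) iter_next_mean_delta //; apply: eq_tsum => u _.
by rewrite mul1r closed_wprod_return.
Qed.

Lemma sum_orders1 x : E x -> sum_orders (fun=> 1) x = (j.+1)`!%:R.
Proof.
move=> Ex; rewrite -(E_size Ex) -(tsum_perm_eq R (E_uniq Ex)) /sum_orders.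
by rewrite (E_size Ex); apply: eq_tsum => y _; rewrite mulr1.
Qed.

Lemma sum_ordersD f1 f2 x :
  sum_orders (fun y => f1 y + f2 y) x = sum_orders f1 x + sum_orders f2 x.
Proof. by rewrite -tsumD; apply: eq_tsum => y _; rewrite mulrDr. Qed.

Lemma sum_ordersZ r f x : sum_orders (fun y => r * f y) x = r * sum_orders f x.
Proof. by rewrite -tsumZ; apply: eq_tsum => y _; rewrite mulrCA. Qed.

Lemma sum_orders_norm f B x : E x -> (forall y, E y -> `|f y| <= B) ->
  `|sum_orders f x| <= (j.+1)`!%:R * B.
Proof.
move=> Ex fB; apply: le_trans (ler_norm_tsum _ _) _.
rewrite mulrC -(sum_orders1 Ex) -sum_ordersZ; apply: ler_tsum => y _.
case xy: (perm_eq x y); last by rewrite !mul0r normr0.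
by rewrite !mul1r mulr1 fB // -(E_perm xy).
Qed.

Lemma boundary_collisions x : E x ->
  boundary (fun v => (~~ uniq v)%:R * closed_wprod j q v) x <=
  l%:R * (j.+1)`!%:R * (collision_rate / N).
Proof.
move=> Ex; rewrite -mulrA /boundary.
rewrite [leRHS]mulr_natl -[X in _ *+ X]card_ord -sumr_const; apply: ler_sum => i _.
have N0 : 0 < N := num_edges_gt0 R E_size Ex.
rewrite (@tsum_closed_walks i (fun v => (~~ uniq v)%:R) (fun s => (perm_eq x s)%:R));
  last by move=> v; rewrite rot_uniq.
rewrite mulrC -(sum_orders1 Ex) -sum_ordersZ; apply: ler_tsum => y sy.
case xy: (perm_eq x y); last by rewrite !mul0r.
have uy : uniq y by rewrite -(perm_uniq xy) E_uniq.
rewrite !mul1r mulr1.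
apply: (@le_trans _ _ (tsum (j + m) (fun u => (2 / n) ^+ l * (~~ uniq (y ++ u))%:R))).
  apply: ler_tsum => u su; rewrite mulrC ler_wpM2r ?ler0n //.
  apply: le_trans (wprod_le _ _ qP) _.
  rewrite !size_cat sy su size_takel ?size_cat ?sy ?su; last by rewrite leqW ?leq_addr.
  by rewrite addnK -lE.
rewrite tsumZ; apply: (@le_trans _ _ ((2 / n) ^+ l *
    (((j + m) * (size y + (j + m)))%:R * n ^+ (j + m) / n))).
  by rewrite ler_wpM2l ?exprn_ge0 ?divr_ge0 ?(ltW V_gt0) // nonuniq_count.
rewrite /collision_rate.
apply: (@le_trans _ _ (2 ^+ l * (l ^ 2)%:R / n / n ^+ j.+1)); last first.
  rewrite ler_wpM2l ?divr_ge0 ?mulr_ge0 ?exprn_ge0 ?ler0n ?(ltW V_gt0) //.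
  by rewrite lef_pV2 ?posrE ?exprn_gt0 // num_edges_le.
have -> : (2 / n) ^+ l * (((j + m) * (size y + (j + m)))%:R * n ^+ (j + m) / n) =
    2 ^+ l * ((j + m) * (size y + (j + m)))%:R / n / n ^+ j.+1.
  rewrite expr_div_n [in n ^+ l]lE [n ^+ (_ + _)]exprD.
  have n0 : n != 0 by rewrite gt_eqF.
  have := expf_neq0 (j + m) n0; have := expf_neq0 j.+1 n0.
  move: n n0 (n ^+ j.+1) (n ^+ (j + m)) (2 ^+ l : R) ((_ * _)%:R : R) => a a0 c d e p c0 d0.
  by field; rewrite a0 c0 d0.
rewrite !ler_wpM2r ?invr_ge0 ?exprn_ge0 ?(ltW V_gt0) //.
by rewrite ler_wpM2l ?exprn_ge0 // ler_nat sy -lE -mulnn leq_mul2r lE leq_addl orbT.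
Qed.

Hypothesis mix2 : forall x y, E x -> E y ->
  (2 * N)^-1 <= iter (m + j.+1) P (fun z => (z == x)%:R) y.

Lemma tilt_bound f F v : (exists x, E x) -> (forall x, E x -> `|f x| <= F) -> 0 <= F ->
  size v = l -> `|tilt f v| <= F * (l%:R^-1 + K) * (N * closed_wprod j q v).
Proof.
move=> [x0 Ex0] fF F0 sv; apply: le_trans (ler_normD _ _) _.
have N0 : 0 < N := num_edges_gt0 R E_size Ex0.
have -> : F * (l%:R^-1 + K) * (N * closed_wprod j q v) =
   F * (N / l%:R) * closed_wprod j q v + K * F * (N * closed_wprod j q v) by ring.
apply: lerD; last exact: (gadget_bound E_perm).
have c0 : 0 <= closed_wprod j q v by exact: w0.
have := edge_mean_norm E_size Ex0 fF; move: (J f) => a aF.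
rewrite !normrM (ger0_norm c0) ler_wpM2r // normfV normr_nat (ger0_norm (ltW N0)).
by rewrite ler_wpM2r ?divr_ge0 ?(ltW N0).
Qed.

Lemma boundary_tilt f F x : E x -> (forall x, E x -> `|f x| <= F) ->
  boundary (tilt f) x =
  sum_orders (fun y => f y - P f y + J f * (N * iter l P (fun z => (z == y)%:R) y)) x.
Proof.
move=> Ex fF; have l0 : l%:R != 0 :> R by rewrite pnatr_eq0.
rewrite boundaryD boundaryZ boundary_closed addrC sum_ordersD; congr (_ + _).
  rewrite /boundary (gadget_boundary E_perm E_uniq E_size g_gt0 V_gt0 deg_ge mix2 fF (perm_ind x)).
  apply: eq_tsum => y _; case xy: (perm_eq x y); last by rewrite !(mulr0, mul0r).
  by rewrite -(E_perm xy) Ex mulr1 !mul1r.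
by rewrite !sum_ordersZ; move: (J f) => a; rewrite -!mulrA mulKf.
Qed.

(** Two errors: return probabilities differ from 1/N, which gives [xi], and non-injective walks are
    discarded, where [tilt_bound] allows [1 + l%:R * K] times the natural weight. *)
Lemma boundary_injective_tilt f F xi x : E x -> (forall x, E x -> `|f x| <= F) -> 0 <= F ->
  (forall y, E y -> `|N * iter l P (fun z => (z == y)%:R) y - 1| <= xi) ->
  `|boundary (injective_tilt f) x - sum_orders (drift f) x| <=
  (j.+1)`!%:R * (F * (xi + (1 + l%:R * K) * collision_rate)).
Proof.
move=> Ex fF F0 ret; have N0 : 0 < N := num_edges_gt0 R E_size Ex.
have xi0 : 0 <= xi := le_trans (normr_ge0 _) (ret _ Ex).
have -> : boundary (injective_tilt f) x = boundary (tilt f) x -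
    boundary (fun v => (~~ uniq v)%:R * tilt f v) x.
  rewrite -[- _]mulN1r -boundaryZ -boundaryD; apply: eq_boundary => v _.
  by rewrite /injective_tilt; case: (uniq v) => /=; ring.
rewrite (boundary_tilt Ex fF).
have -> : sum_orders (fun y => f y - P f y + J f * (N * iter l P (fun z => (z == y)%:R) y)) x =
    sum_orders (drift f) x +
    sum_orders (fun y => J f * (N * iter l P (fun z => (z == y)%:R) y - 1)) x.
  by rewrite -sum_ordersD; apply: eq_tsum => y _; rewrite /drift; ring.
rewrite [X in `|X|](_ : _ =
   sum_orders (fun y => J f * (N * iter l P (fun z => (z == y)%:R) y - 1)) x -
   boundary (fun v => (~~ uniq v)%:R * tilt f v) x); last by ring.
apply: le_trans (ler_normB _ _) _; rewrite mulrDr mulrDr; apply: lerD.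
  apply: sum_orders_norm => // y Ey; rewrite normrM.
  by apply: ler_pM => //; [apply: edge_mean_norm Ex fF | apply: ret].
apply: (@le_trans _ _ (boundary (fun v => F * (l%:R^-1 + K) * N *
    ((~~ uniq v)%:R * closed_wprod j q v)) x)).
  apply: boundary_norm => v sv; rewrite normrM normr_nat.
  have := tilt_bound (ex_intro _ x Ex) fF F0 sv.
  case: (uniq v); rewrite /= ?mul0r ?mulr0 // ?mul1r.
  by rewrite mulrA.
rewrite boundaryZ.
have K_ge0 : 0 <= K by rewrite divr_ge0 ?ler0n ?exprn_ge0 // ltW.
apply: le_trans (ler_wpM2l _ (boundary_collisions Ex)) _.
  by rewrite !mulr_ge0 ?addr_ge0 ?invr_ge0 ?ler0n // ltW.
rewrite le_eqVlt; apply/orP; left; apply/eqP.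
have l0 : l%:R != 0 :> R by rewrite pnatr_eq0.
have {}N0 : N != 0 by rewrite gt_eqF.
move: K collision_rate N ((j.+1)`!%:R) (l%:R : R) N0 l0 => a c d e p d0 p0.
by field; rewrite d0 p0.
Qed.

Lemma tilt_lin r f1 f2 v :
  tilt (fun y => r * f1 y + f2 y) v = r * tilt f1 v + tilt f2 v.
Proof.
rewrite /tilt gadget_lin.
have -> : J (fun y => r * f1 y + f2 y) = r * J f1 + J f2; last by ring.
rewrite /edge_mean mulrA -mulrDl -tsumZ -tsumD; congr (_ / _).
by apply: eq_tsum => y _; ring.
Qed.

Lemma drift_lin r f1 f2 v :
  drift (fun y => r * f1 y + f2 y) v = r * drift f1 v + drift f2 v.
Proof.
rewrite /drift.
have -> : J (fun y => r * f1 y + f2 y) = r * J f1 + J f2.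
  rewrite /edge_mean mulrA -mulrDl -tsumZ -tsumD; congr (_ / _).
  by apply: eq_tsum => y _; ring.
have -> : P (fun y => r * f1 y + f2 y) v = r * P f1 v + P f2 v; last by ring.
by rewrite /next_mean mulr_sumr -big_split; apply: eq_bigr => a _ /=; ring.
Qed.

Lemma closed_wprod_edges v i : size v = l -> closed_wprod j q v != 0 ->
  E (take j.+1 (rot i v)).
Proof.
move=> sv; have jv : (j < size v)%N by rewrite sv lE leq_addr.
rewrite -(closed_wprod_rot q i jv) => c0.
have i0 : (0 < size (rot i v ++ take j (rot i v)) - j)%N.
  by rewrite size_cat size_rot size_takel ?size_rot ?(ltnW jv) // addnK (leq_ltn_trans _ jv).
have := wprod_neq0 i0 c0; rewrite drop0 takel_cat ?size_rot //.
exact: tight_prob_neq0.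
Qed.

Variables (x0 : seq V) (xi : R).
Hypothesis Ex0 : E x0.
Hypothesis ret : forall y, E y -> `|N * iter l P (fun z => (z == y)%:R) y - 1| <= xi.

Local Notation beta := (xi + (1 + l%:R * K) * collision_rate).

(** [2 * K0 * beta] will bound the solution, and [1 + l%:R * K] compares [tilt] with the background:
    this keeps the final weights nonnegative. As the last factor is at least 1, it also yields the
    invertibility condition [K0beta]. *)
Hypothesis small : 2 * K0 * beta * (1 + l%:R * K) <= 1.

Let fact_gt0 : 0 < (j.+1)`!%:R :> R. Proof. by rewrite ltr0n fact_gt0. Qed.
Let K_ge0 : 0 <= K. Proof. by rewrite divr_ge0 ?ler0n ?exprn_ge0 // ltW. Qed.
Let lK_ge1 : 1 <= 1 + l%:R * K. Proof. by rewrite lerDl mulr_ge0. Qed.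
Let rate_ge0 : 0 <= collision_rate.
Proof. by rewrite divr_ge0 ?mulr_ge0 ?exprn_ge0 ?ler0n // ltW. Qed.
Let xi_ge0 : 0 <= xi. Proof. exact: le_trans (normr_ge0 _) (ret Ex0). Qed.
Let beta_ge0 : 0 <= beta.
Proof. by rewrite addr_ge0 // mulr_ge0 // (le_trans ler01). Qed.
Let K0_ge0 : 0 <= K0. Proof. by rewrite addr_ge0 // divr_ge0 ?ler0n ?exprn_ge0 // ltW. Qed.

Let K0beta : 2 * K0 * beta <= 1.
Proof.
apply: le_trans small; rewrite ler_peMr // mulr_ge0 //.
by rewrite mulr_ge0.
Qed.

(* Summing [corrected_drift f] over the
   orderings of an edge gives the boundary of [injective_tilt f] exactly, while pointwise it is a
   small perturbation of [drift f], which is invertible by [poisson_bound]. *)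
Definition corrected_drift f x : R :=
  drift f x + (boundary (injective_tilt f) x - sum_orders (drift f) x) / (j.+1)`!%:R.

Lemma corrected_drift_lin r f1 f2 x :
  corrected_drift (fun y => r * f1 y + f2 y) x =
  r * corrected_drift f1 x + corrected_drift f2 x.
Proof.
rewrite /corrected_drift drift_lin.
have -> : boundary (injective_tilt (fun y => r * f1 y + f2 y)) x =
    r * boundary (injective_tilt f1) x + boundary (injective_tilt f2) x.
  rewrite -boundaryZ -boundaryD; apply: eq_boundary => v _.
  by rewrite /injective_tilt tilt_lin; ring.
have -> : sum_orders (drift (fun y => r * f1 y + f2 y)) x =
    r * sum_orders (drift f1) x + sum_orders (drift f2) x.
  rewrite -sum_ordersZ -sum_ordersD; apply: eq_tsum => y _; by rewrite drift_lin.
by ring.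
Qed.

(** The correction is at most [beta] times the maximum of [|f|]; applying [poisson_bound] at the
    maximiser, [K0 * beta <= 1 / 2] absorbs it. With [B = 0] this is injectivity. *)
Lemma corrected_drift_bound f B : (forall x, E x -> `|corrected_drift f x| <= B) ->
  forall x, E x -> `|f x| <= 2 * K0 * B.
Proof.
move=> fB; have [x1 Ex1 max1] := min_on_edges E_size (fun x => - `|f x|) Ex0.
have fF x : E x -> `|f x| <= `|f x1| by move=> /max1; rewrite lerN2.
have dB x : E x -> `|drift f x| <= B + beta * `|f x1|.
  move=> Ex; set e := (boundary (injective_tilt f) x - sum_orders (drift f) x) / (j.+1)`!%:R.
  have -> : drift f x = corrected_drift f x - e by rewrite addrK.
  apply: le_trans (ler_normB _ _) _; apply: lerD; first exact: fB.
  rewrite normrM normfV normr_nat ler_pdivrMr //.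
  by rewrite [leRHS]mulrC [beta * _]mulrC boundary_injective_tilt.
have := poisson_bound E_perm E_uniq E_size g_gt0 V_gt0 deg_ge dB Ex1.
have := ler_wpM2r (normr_ge0 (f x1)) K0beta.
move=> h1 h2 x /fF; move: h1 h2; move: (`|f x|) (`|f x1|) => a c h1 h2; lra.
Qed.

Let base v : R := (uniq v)%:R * (N / l%:R * closed_wprod j q v).

Lemma boundary_base x : E x ->
  `|boundary base x - (j.+1)`!%:R| <= (j.+1)`!%:R * beta.
Proof.
move=> Ex; have N0 : 0 < N := num_edges_gt0 R E_size Ex0.
have l0 : l%:R != 0 :> R by rewrite pnatr_eq0.
have -> : boundary base x = N / l%:R * boundary (closed_wprod j q) x -
    N / l%:R * boundary (fun v => (~~ uniq v)%:R * closed_wprod j q v) x.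
  rewrite -mulrBr -[- _]mulN1r -boundaryZ -boundaryD -boundaryZ.
  by apply: eq_boundary => v _; rewrite /base; case: (uniq v) => /=; ring.
rewrite boundary_closed -(sum_orders1 Ex) mulrA divfK //.
set C := N / l%:R * _.
have -> : N * sum_orders (fun y => iter l P (fun z => (z == y)%:R) y) x - C -
    sum_orders (fun=> 1) x =
    sum_orders (fun y => N * iter l P (fun z => (z == y)%:R) y - 1) x - C.
  rewrite addrAC; congr (_ - _); rewrite -sum_ordersZ -[- sum_orders _ _]mulN1r.
  by rewrite -sum_ordersZ -sum_ordersD; apply: eq_tsum => y _; rewrite mulN1r.
apply: le_trans (ler_normB _ _) _; rewrite (sum_orders1 Ex) mulrDr; apply: lerD.
  exact: sum_orders_norm.
have C0 : 0 <= C.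
  rewrite mulr_ge0 ?divr_ge0 ?(ltW N0) //; apply: sumr_ge0 => i _; apply: tsum_ge0 => v _.
  by rewrite !mulr_ge0 // ; exact: w0.
rewrite ger0_norm //.
apply: (@le_trans _ _ ((j.+1)`!%:R * collision_rate)).
  apply: le_trans (ler_wpM2l _ (boundary_collisions Ex)) _; first by rewrite divr_ge0 // ltW.
  rewrite le_eqVlt; apply/orP; left; apply/eqP.
  have {}N0 : N != 0 by rewrite gt_eqF.
  move: collision_rate N ((j.+1)`!%:R) (l%:R : R) N0 l0 => c d e p d0 p0.
  by field; rewrite d0 p0.
by rewrite ler_wpM2l ?(ltW fact_gt0) // ler_peMl.
Qed.

Lemma exists_walk_weights : exists W : seq V -> R,
  [/\ forall v, size v = l -> 0 <= W v,
      forall v, size v = l -> W v != 0 -> uniq v /\ forall i, E (take j.+1 (rot i v)) &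
      forall x, E x -> boundary W x = (j.+1)`!%:R].
Proof.
(* Linear algebra needs a finite index type, so functions on sequences are restricted to tuples and
   extended back by 0. *)
pose ext (h : j.+1.-tuple V -> R) s := if insub s is Some t then h t else 0.
pose A (h : j.+1.-tuple V -> R) (t : j.+1.-tuple V) := corrected_drift (ext h) t.
have extE (h : j.+1.-tuple V -> R) (t : j.+1.-tuple V) : ext h t = h t by rewrite /ext valK.
have [] := @uniq_linear_surjective R (j.+1.-tuple V) (fun t : j.+1.-tuple V => E t) A _ _
    (fun t : j.+1.-tuple V => - ((boundary base t) / (j.+1)`!%:R - 1)).
- move=> r f1 f2 t; rewrite /A -corrected_drift_lin; congr (corrected_drift _ _).
  by apply/boolp.funext => s; rewrite /ext; case: insubP => //; rewrite mulr0 addr0.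
- move=> f Af0 t Et; rewrite -extE.
  have /corrected_drift_bound h x : E x -> `|corrected_drift (ext f) x| <= 0.
    move=> Ex; have := Af0 (tcast (E_size Ex) (in_tuple x)).
    by rewrite /A val_tcast => ->; rewrite ?normr0.
  by have := h _ Et; rewrite mulr0 normr_le0 => /eqP.
move=> h0 Ah0; pose h := ext h0.
have Ah x : E x -> corrected_drift h x = 1 - boundary base x / (j.+1)`!%:R.
  move=> Ex; have := Ah0 (tcast (E_size Ex) (in_tuple x)).
  by rewrite /A val_tcast => ->; rewrite // opprB.
have hb x : E x -> `|h x| <= 2 * K0 * beta.
  apply: corrected_drift_bound => y Ey; rewrite Ah // distrC.
  rewrite -[X in _ - X](mulfV (lt0r_neq0 fact_gt0)) -mulrBl normrM normfV normr_nat.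
  by rewrite ler_pdivrMr // mulrC boundary_base.
have hb0 : 0 <= 2 * K0 * beta by rewrite !mulr_ge0.
(* The correction never exceeds the background: the sum is nonnegative, and it vanishes wherever the
   background does. *)
have tb v : size v = l -> `|tilt h v| <= N / l%:R * closed_wprod j q v.
  move=> sv; apply: le_trans (tilt_bound (ex_intro _ x0 Ex0) hb hb0 sv) _.
  have -> : 2 * K0 * beta * (l%:R^-1 + K) * (N * closed_wprod j q v) =
      2 * K0 * beta * (1 + l%:R * K) * (N / l%:R * closed_wprod j q v).
    have l0 : l%:R != 0 :> R by rewrite pnatr_eq0.
    move: K N (closed_wprod j q v) (l%:R : R) l0 (2 * K0 * beta) => c d e p p0 a.
    by field.
  rewrite ler_piMl //; apply: mulr_ge0; last exact: w0.
  by rewrite divr_ge0 // ltW // (num_edges_gt0 R E_size Ex0).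
exists (fun v => base v + injective_tilt h v); split.
- move=> v sv; rewrite /base /injective_tilt -mulrDr mulr_ge0 //.
  by have := tb v sv; rewrite ler_norml => /andP[+ _]; rewrite -subr_ge0 opprK addrC.
- move=> v sv; rewrite /base /injective_tilt -mulrDr mulf_eq0 negb_or pnatr_eq0 eqb0 negbK.
  move=> /andP[uv W0]; split => // i; apply: closed_wprod_edges => //.
  apply: contraNneq W0 => c0; have := tb v sv.
  by rewrite c0 !mulr0 normr_le0 => /eqP ->; rewrite addr0.
move=> x Ex; rewrite boundaryD.
have bE W y : perm_eq x y -> boundary W y = boundary W x.
  move=> xy; apply: eq_bigr => i _; apply: eq_tsum => v _.
  by rewrite -(permPl xy).
have : sum_orders (corrected_drift h) x =
    sum_orders (fun=> 1 - boundary base x / (j.+1)`!%:R) x.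
  apply: eq_tsum => y _; case xy: (perm_eq x y); last by rewrite !mul0r.
  by rewrite Ah -?(E_perm xy) // (bE _ _ xy).
have sum_cst r : sum_orders (fun=> r) x = (j.+1)`!%:R * r.
  rewrite -(sum_orders1 Ex) mulrC -sum_ordersZ; apply: eq_tsum => y _; by rewrite mulr1.
have -> : sum_orders (corrected_drift h) x = boundary (injective_tilt h) x.
  rewrite sum_ordersD.
  have -> : sum_orders (fun y => (boundary (injective_tilt h) y - sum_orders (drift h) y) /
      (j.+1)`!%:R) x =
      sum_orders (fun=> (boundary (injective_tilt h) x - sum_orders (drift h) x) / (j.+1)`!%:R) x.
    apply: eq_tsum => y _; case xy: (perm_eq x y); last by rewrite !mul0r.
    rewrite (bE _ _ xy); congr (_ * ((_ - _) / _)); apply: eq_tsum => z _.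
    by rewrite -(permPl xy).
  by rewrite sum_cst [_ * (_ / _)]mulrC divfK ?lt0r_neq0 // addrC subrK.
by rewrite sum_cst => ->; rewrite mulrBr mulr1 [_ * (_ / _)]mulrC divfK ?lt0r_neq0 // addrC subrK.
Qed.

End Assembly.

(** * From closed walks to tight cycles *)

(** With [phi = (1 + th) / 2] one has [th <= phi ^+ 2], and Bernoulli's inequality bounds [phi ^+ i]
    by a multiple of 1/i; so [th ^+ i] is O(1/i^2), which beats the linear factor. *)
Lemma geometric_decay (R : realType) (th c : R) : 0 <= th < 1 -> 0 < c ->
  exists i0 : nat, forall i, (i0 <= i)%N -> (i + 3)%:R * th ^+ i <= c.
Proof.
move=> /andP[th0 th1] c0.
pose phi : R := (1 + th) / 2; pose a : R := phi^-1 - 1.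
have phi0 : 0 < phi by rewrite /phi; lra.
have phi1 : phi < 1 by rewrite /phi; lra.
have a0 : 0 < a by rewrite subr_gt0 invf_gt1.
have phia : phi * (1 + a) = 1 by rewrite addrC subrK mulfV ?gt_eqF.
have bernoulli i : phi ^+ i * (i%:R * a) <= 1.
  suff h : phi ^+ i * (1 + i%:R * a) <= 1.
    by apply: le_trans h; rewrite ler_wpM2l ?exprn_ge0 ?(ltW phi0) // lerDr.
  elim: i => [|i IH]; first by rewrite mul0r addr0 mulr1.
  apply: le_trans IH; rewrite exprSr -mulrA ler_wpM2l ?exprn_ge0 ?(ltW phi0) //.
  have -> : 1 + i%:R * a = phi * ((1 + a) * (1 + i%:R * a)) by rewrite mulrA phia mul1r.
  rewrite ler_wpM2l ?(ltW phi0) // -natr1.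
  have : 0 <= a * (i%:R * a) by rewrite !mulr_ge0 // ltW.
  lra.
have th_phi : th <= phi ^+ 2.
  have := sqr_ge0 (1 - th); rewrite /phi expr2; rewrite !expr2; lra.
pose c1 := 4 / (a ^+ 2 * c).
have c10 : 0 < c1 by rewrite divr_gt0 // mulr_gt0 // exprn_gt0.
exists (Num.truncn c1).+1 => i i0i.
have ic : c1 <= i%:R.
  apply: le_trans (ltW (truncnS_gt c1)) _; by rewrite ler_nat.
have i0 : 0 < i%:R :> R by apply: lt_le_trans ic.
have i1 : 1 <= i%:R :> R by rewrite ler1n -(ltr0n R).
have pi2 : phi ^+ i <= (i%:R * a)^-1.
  by rewrite -[leRHS]mul1r ler_pdivlMr ?mulr_gt0.
have thi : th ^+ i <= (i%:R * a)^-1 * (i%:R * a)^-1.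
  apply: (@le_trans _ _ ((phi ^+ 2) ^+ i)); first by rewrite lerXn2r ?nnegrE // exprn_ge0 // ltW.
  by rewrite -exprM mulnC exprM expr2 ler_pM ?exprn_ge0 ?(ltW phi0).
apply: (@le_trans _ _ ((4 * i%:R) * ((i%:R * a)^-1 * (i%:R * a)^-1))).
  apply: ler_pM => //; first by rewrite exprn_ge0.
  rewrite natrD; lra.
have -> : (4 * i%:R) * ((i%:R * a)^-1 * (i%:R * a)^-1) = 4 / (a ^+ 2 * i%:R).
  move: (i%:R : R) i0 => p p0; rewrite expr2; field; by rewrite !gt_eqF.
rewrite ler_pdivrMr ?mulr_gt0 ?exprn_gt0 //.
have := ic; rewrite /c1 ler_pdivrMr ?mulr_gt0 ?exprn_gt0 //.
by rewrite mulrA [c * _]mulrC [i%:R * _]mulrC -mulrA [i%:R * c]mulrC mulrA.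
Qed.

Section CyclicSegments.
Variables (k l : nat).
Implicit Types (i : 'I_l).

Lemma val_iter_ordS r i : iter r (@ordS l) i = ((i + r) %% l)%N :> nat.
Proof.
elim: r => [|r IH]; first by rewrite addn0 modn_small.
by rewrite iterS /= IH -addn1 modnDml addn1 addnS.
Qed.

(** If the start [i'] were not [i], its predecessor would lie in the common segment, so [i'] would
    return to itself in at most [k < l] steps. *)
Lemma cyclic_segment_inj : (0 < k < l)%N -> injective (@cyclic_segment k l).
Proof.
move=> /andP[k0 kl] i i' ii'.
have : i' \in cyclic_segment k i by rewrite ii'; apply/imsetP; exists (Ordinal k0).
case/imsetP => -[[|p] /= pk] _ i'E; first by rewrite i'E.
have : iter p (@ordS l) i \in cyclic_segment k i'.
  by rewrite -ii'; apply/imsetP; exists (Ordinal (ltnW pk)).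
case/imsetP => -[r rk] _ /= /(congr1 (@ordS l)).
rewrite -i'E -iterS => /(congr1 (@nat_of_ord l)); rewrite val_iter_ordS => /eqP.
rewrite -{1}[nat_of_ord i'](@modn_small _ l) // -{1}[nat_of_ord i']addn0 eqn_modDl mod0n.
by rewrite modn_small // (leq_ltn_trans rk).
Qed.

Variables (V : finType) (v : l.-tuple V).

Lemma imset_cyclic_segment i : (k <= l)%N ->
  (tnth v @: cyclic_segment k i)%SET = [set x in take k (rot i v)]%SET.
Proof.
move=> kl; have il := ltn_ord i; have l0 : (0 < l)%N by apply: leq_ltn_trans il.
have x0 : V := tnth v i.
have nthE r : (r < l)%N -> nth x0 (rot i v) r = nth x0 v ((i + r) %% l)%N.
  move=> rl; rewrite /rot nth_cat size_drop size_tuple nth_drop.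
  case: ltnP => h; first by rewrite modn_small // -ltn_subRL.
  have irl : (l <= i + r)%N by rewrite -leq_subLR.
  rewrite nth_take; last by move: rl il irl; clear; lia.
  congr nth; rewrite -[in RHS](subnK irl) modnDr modn_small; lia.
apply/setP => x; rewrite inE; apply/imsetP/idP => [[y /imsetP[r _ ->] ->]|xw].
  have rl : (r < l)%N by apply: leq_trans kl.
  rewrite (tnth_nth x0) val_iter_ordS -nthE // -(nth_take x0 (ltn_ord r)) mem_nth //.
  by rewrite size_takel ?size_rot ?size_tuple.
have sw : size (take k (rot i v)) = k by rewrite size_takel ?size_rot ?size_tuple.
have rk : (index x (take k (rot i v)) < k)%N by rewrite -[X in (_ < X)%N]sw index_mem.
exists (iter (index x (take k (rot i v))) (@ordS l) i).
  by apply/imsetP; exists (Ordinal rk).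
rewrite (tnth_nth x0) val_iter_ordS -nthE ?(leq_trans rk) //.
by rewrite -(nth_take x0 rk) nth_index.
Qed.

Definition cycle_copy : {set V} * {set {set V}} :=
  ([set x in v], [set [set x in take k (rot i v)] | i : 'I_l])%SET.

Lemma card_cycle_windows (e : {set V}) : (0 < k < l)%N -> uniq v ->
  (\sum_(i < l) (e == [set x in take k (rot i v)]%SET) = (e \in cycle_copy.2))%N.
Proof.
move=> kl uv; have kl' : (k <= l)%N by case/andP: kl => _ /ltnW.
have inj i i' : [set x in take k (rot i v)]%SET = [set x in take k (rot i' v)]%SET -> i = i'.
  have vinj : injective (tnth v) by apply/tuple_uniqP.
  by rewrite -!imset_cyclic_segment // => /(imset_inj vinj) /(cyclic_segment_inj kl).
have [/imsetP[i0 _ ->]|ne] := boolP (e \in _).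
  rewrite (bigD1 i0) //= eqxx big1 // => i ne.
  by apply/eqP; rewrite eqb0; apply: contra ne => /eqP/inj ->.
rewrite big1 // => i _; apply/eqP; rewrite eqb0; apply: contra ne => /eqP ->.
exact: imset_f.
Qed.

Lemma cycle_copy_in_copies (H : kgraph k V) : (0 < k < l)%N -> uniq v ->
  (forall i : nat, [set x in take k (rot i v)]%SET \in edges H) ->
  cycle_copy \in copies (tight_cycle k l) H.
Proof.
move=> /andP[k0 kl] uv vH; have kl' := ltnW kl.
have finj : injective (tnth v) by apply/tuple_uniqP.
rewrite inE; apply/andP; split.
  apply/andP; split; first by apply/subsetP => _ /imsetP[i _ ->].
  apply/forall_inP => _ /imsetP[i _ ->]; apply/subsetP => x.
  by rewrite !inE => /mem_take; rewrite mem_rot.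
apply/existsP; exists [ffun i => tnth v i].
have fE (A : {set 'I_l}) : ([ffun i => tnth v i] @: A)%SET = (tnth v @: A)%SET.
  by apply: eq_imset => i; rewrite ffunE.
apply/and3P; split.
- by apply/injectiveP => i i'; rewrite !ffunE => /finj.
- apply/eqP/setP => x; rewrite fE inE; apply/tnthP/imsetP => [[i ->]|[i _ ->]]; by exists i.
apply/eqP/setP => e; apply/imsetP/imsetP => [[i _ ->]|[s + ->]].
  exists (cyclic_segment k i); last by rewrite fE imset_cyclic_segment.
  rewrite inE -(card_imset _ finj) imset_cyclic_segment //.
  by rewrite (edges_uniform (vH i)) eqxx; apply/existsP; exists i.
by rewrite inE fE => /andP[_ /existsP[i /eqP ->]]; exists i; rewrite ?imset_cyclic_segment.
Qed.

End CyclicSegments.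

(** Walks tracing the same copy are pooled. An injective walk meets an edge of its copy in exactly
    one window, so window counts are edge coverings. *)
Lemma fractional_decomposition_of_walks (R : realType) (k l : nat) (V : finType)
    (H : kgraph k V) (W : seq V -> R) (a : R) :
  (0 < k < l)%N -> 0 < a ->
  (forall v, size v = l -> 0 <= W v) ->
  (forall v, size v = l -> W v != 0 ->
     uniq v /\ forall i, [set x in take k (rot i v)]%SET \in edges H) ->
  (forall s, uniq s -> [set x in s]%SET \in edges H ->
     \sum_(i < l) tsum l (fun v => W v * (perm_eq s (take k (rot i v)))%:R) = a) ->
  exists w : {set V} * {set {set V}} -> R, fractional_decomposition (tight_cycle k l) H w.
Proof.
move=> kl a0 W0 Wedge Wa.
pose w S := a^-1 * \sum_(v : l.-tuple V | cycle_copy k v == S) W v.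
have w0 S : 0 <= w S.
  by rewrite mulr_ge0 ?invr_ge0 ?(ltW a0) // sumr_ge0 // => v _; rewrite W0 ?size_tuple.
have w1 e : e \in edges H ->
    \sum_(S in copies (tight_cycle k l) H | e \in S.2) w S = 1.
  move=> eH; rewrite -mulr_sumr.
  have -> : \sum_(S in copies (tight_cycle k l) H | e \in S.2)
      \sum_(v : l.-tuple V | cycle_copy k v == S) W v =
      \sum_(v : l.-tuple V | (cycle_copy k v \in copies (tight_cycle k l) H) &&
        (e \in (cycle_copy k v).2)) W v.
    rewrite [RHS](partition_big (@cycle_copy k l V) (fun S =>
      (S \in copies (tight_cycle k l) H) && (e \in S.2))) //=.
    apply: eq_bigr => S SP; apply: eq_bigl => v.
    have [vS|_] := eqVneq (cycle_copy k v) S; last by rewrite andbF.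
    by move: SP; rewrite -vS /= => ->.
  suff -> : \sum_(v : l.-tuple V | (cycle_copy k v \in copies (tight_cycle k l) H) &&
        (e \in (cycle_copy k v).2)) W v = a by rewrite mulVf ?gt_eqF.
  have es : [set x in enum e]%SET = e by apply/setP => x; rewrite inE mem_enum.
  rewrite -(Wa (enum e)) ?enum_uniq ?es // exchange_tsum big_mkcond; apply: eq_bigr => v _.
  rewrite -mulr_sumr.
  have [->|Wv] := eqVneq (W v) 0; first by rewrite mul0r; case: ifP.
  have [uv vH] := Wedge v (size_tuple v) Wv.
  rewrite (cycle_copy_in_copies kl uv vH) /=.
  have -> : \sum_(i < l) (perm_eq (enum e) (take k (rot i v)))%:R =
      (e \in (cycle_copy k v).2)%:R :> R.
    rewrite -(card_cycle_windows e kl uv) natr_sum; apply: eq_bigr => i _; congr _%:R.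
    congr nat_of_bool; apply/idP/eqP => [ee|->].
      by rewrite -[LHS]es; apply/setP => x; rewrite !inE (perm_mem ee).
    apply: uniq_perm; rewrite ?enum_uniq ?take_uniq ?rot_uniq //.
    by move=> x; rewrite mem_enum inE.
  by case: ifP; rewrite ?mulr1 ?mulr0.
exists w; split => // S SC; rewrite w0 /=.
(* For the upper bound 1, any edge of the copy will do: the weights of all copies through it are
   nonnegative and sum to 1. *)
have /set0Pn[e eS] : S.2 != set0%SET.
  have := SC; rewrite inE => /andP[_ /existsP[f /and3P[_ _ /eqP ->]]].
  have : (0 < #|edges (tight_cycle k l)|)%N.
    exact: leq_trans (card_tight_cycle_edges_gt1 kl).
  by case/card_gt0P => s sC; apply/set0Pn; exists (f @: s)%SET; apply: imset_f.
have eH : e \in edges H.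
  by have := SC; rewrite inE => /andP[/andP[/subsetP/(_ _ eS)]].
rewrite -(w1 e eH) (bigD1 S) /=; last by rewrite SC.
by rewrite lerDl sumr_ge0.
Qed.

Definition ordered_edge (k : nat) (V : finType) (H : kgraph k V) (s : seq V) : bool :=
  uniq s && ([set x in s]%SET \in edges H).

Section OrderedEdges.
Variables (k : nat) (V : finType) (H : kgraph k V).

Lemma ordered_edge_perm s t : perm_eq s t -> ordered_edge H s = ordered_edge H t.
Proof.
move=> st; rewrite /ordered_edge (perm_uniq st).
suff -> : [set x in s]%SET = [set x in t]%SET by [].
by apply/setP => x; rewrite !inE (perm_mem st).
Qed.

Lemma ordered_edge_uniq s : ordered_edge H s -> uniq s.
Proof. by case/andP. Qed.

Lemma ordered_edge_size s : ordered_edge H s -> size s = k.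
Proof. by case/andP => /card_uniqP <- /edges_uniform <-; rewrite cardsE. Qed.

Lemma min_degree_le_deg (R : realFieldType) t : (0 < k)%N -> uniq t -> size t = k.-1 ->
  (min_degree H)%:R <= deg R (ordered_edge H) t.
Proof.
move=> k0 ut st; pose x : {set V} := [set y in t]%SET.
have xk : #|x| = k.-1 by rewrite cardsE -st; exact/card_uniqP.
have : (min_degree H <= degree H x)%N.
  by rewrite -leEnat; apply: bigmin_le_cond; rewrite xk.
rewrite /deg -natr_sum ler_nat => /leq_trans; apply.
have -> : (\sum_(v : V) ordered_edge H (v :: t) = #|[set v | ordered_edge H (v :: t)]|)%N.
  rewrite -sum1_card [RHS]big_mkcond; apply: eq_bigr => v _; rewrite inE.
  by case: ordered_edge.
apply: leq_trans (leq_imset_card (fun v => v |: x)%SET _).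
apply/subset_leq_card/subsetP => e; rewrite inE => /andP[eH xe].
have ek := edges_uniform eH.
have : #|e :\: x| = 1%N.
  have := cardsID x e; rewrite (setIidPr xe) xk ek.
  by rewrite -(prednK k0) /= -addn1 => /addnI.
move/eqP/cards1P => [v hv].
have ev : e = (v |: x)%SET by rewrite -hv setUC -[LHS](setID e x) (setIidPr xe).
apply/imsetP; exists v => //; rewrite inE /ordered_edge /= ut andbT.
have /[!inE] /andP[-> _] /= : v \in (e :\: x)%SET by rewrite hv set11.
suff -> : [set y in v :: t]%SET = e by [].
by rewrite ev; apply/setP => y; rewrite !inE.
Qed.

End OrderedEdges.

(** [m] is the length of the return path left by the [2 * b.+1 + 1] vertices of a gadget, and
    [m %/ b.+2] is the number of contracting blocks; the [3] covers the gadget and the remainder. *)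
Lemma cycle_length_split b i0 l : (b.+2 * i0 + 2 * b.+2 <= l)%N ->
  exists m, [/\ l = (b.+1 + (b.+1 + m).+1)%N, (0 < b.+2 < l)%N, (i0 <= m %/ b.+2)%N,
    (l <= b.+2 * (m %/ b.+2 + 3))%N & (m + b.+2 <= l)%N].
Proof.
move=> ll0; exists (l - (b.+1 + b.+2))%N; split; try lia.
by rewrite leq_divRL // mulnC; lia.
Qed.

Theorem theorem1p3 (R : realType) (k : nat) (hk : (2 <= k)%N)
    (eps : R) (heps : 0 < eps) :
  exists l0 : nat, (1 <= l0)%N /\
    forall l : nat, (l0 <= l)%N ->
      fractional_threshold R (tight_cycle k l) <= 1 / 2 + eps.
Proof.
have [b kb] : exists b, k = b.+2 by exists k.-2; case: k hk => [|[]].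
rewrite {hk}kb.
(* The bound [2 * eps] makes the degree condition imply [deg_ge]; the cap [1 / 2] ensures
   [g < 1]. *)
pose g : R := Num.min (2 * eps) (1 / 2).
have g0 : 0 < g by rewrite lt_min mulr_gt0 //= divr_gt0.
have g1 : g < 1 by rewrite gt_min; apply/orP; right; lra.
have geps : (1 + g) / 2 <= 1 / 2 + eps.
  have : g <= 2 * eps by rewrite ge_min lexx.
  lra.
pose K : R := gadget_cost b g; pose K0 : R := 1 + (4 * b.+2)%:R / g ^+ b.+2.
have K_ge0 : 0 <= K by rewrite divr_ge0 ?ler0n ?exprn_ge0 // ltW.
have K0_ge1 : 1 <= K0 by rewrite lerDl divr_ge0 ?ler0n ?exprn_ge0 // ltW.
have K0_gt0 : 0 < K0 by apply: lt_le_trans K0_ge1.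
have K0_ge0 := ltW K0_gt0.
pose th : R := 1 - g ^+ b.+2.
have th01 : 0 <= th < 1.
  by rewrite subr_ge0 exprn_ile1 ?ltW //= gtrBl exprn_gt0.
pose kK : R := 1 + b.+2%:R * K.
have kK_gt0 : 0 < kK by rewrite ltr_pwDl // mulr_ge0.
(* With [i = m %/ b.+2], [4 * K0 * xi * lK] will be at most [c * ((i + 3)%:R * th ^+ i)]; [c] does
   not involve [l]. *)
pose c : R := 4 * K0 * 2 ^+ b.+2 * kK.
have c_gt0 : 0 < c by rewrite mulr_gt0 // mulr_gt0 ?exprn_gt0 // mulr_gt0.
have [i0 hi0] := geometric_decay th01 (etrans (invr_gt0 c) c_gt0).
exists (b.+2 * i0 + 2 * b.+2)%N; split; first by rewrite addn_gt0 orbT.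
move=> l ll0.
have [m [lm kl hi lk ml]] := cycle_length_split ll0.
pose xi : R := th ^+ (m %/ b.+2) * 2 ^+ b.+2.
pose lK : R := 1 + l%:R * K.
have lK_ge1 : 1 <= lK by rewrite lerDl mulr_ge0.
have lK_le : lK <= kK * (m %/ b.+2 + 3)%:R.
  have i3 : 1 <= (m %/ b.+2 + 3)%:R :> R by rewrite ler1n addn_gt0 orbT.
  have h : l%:R * K <= b.+2%:R * (m %/ b.+2 + 3)%:R * K.
    by rewrite ler_wpM2r // -natrM ler_nat.
  by rewrite /lK /kK [leRHS]mulrDl mul1r [b.+2%:R * K * _]mulrAC lerD.
have xi_ge0 : 0 <= xi by rewrite mulr_ge0 ?exprn_ge0 //; case/andP: th01.
have xi_small : 4 * K0 * xi * lK <= 1.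
  apply: (@le_trans _ _ (4 * K0 * xi * (kK * (m %/ b.+2 + 3)%:R))).
    by rewrite ler_wpM2l // mulr_ge0 // mulr_ge0.
  have := hi0 _ hi; rewrite -[leRHS]mul1r ler_pdivlMr //.
  apply: le_trans; rewrite le_eqVlt; apply/orP; left; apply/eqP; rewrite /xi /c; ring.
(* For n at least [D] the collisions use up at most half of the bound in [small], the other half
   being [xi_small]. [D] may depend on [l], which is fixed by now. *)
pose D : R := 4 * K0 * lK ^+ 2 * (2 ^+ l * (l ^ 2)%:R).
apply: fractional_threshold_le; first exact: card_tight_cycle_edges_gt1.
move=> mu mu0; exists (maxn 1 (Num.truncn D).+1) => V H; rewrite geq_max => /andP[V1 VD] Hdeg.
have V0 : 0 < #|V|%:R :> R by rewrite ltr0n.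
have DV : D <= #|V|%:R by rewrite (le_trans (ltW (truncnS_gt D))) // ler_nat.
pose E := ordered_edge H.
have [/existsP[x0 Ex0]|/existsPn noE] := boolP [exists x : b.+2.-tuple V, E x]; last first.
  (* Without edges there is nothing to cover; otherwise [x0] guarantees [N > 0]. *)
  exists (fun=> 0); split=> [S _|e eH]; first by rewrite lexx ler01.
  have se : size (enum e) = b.+2 by rewrite -cardE (edges_uniform eH).
  have := noE (tcast se (in_tuple (enum e))); rewrite val_tcast /E /ordered_edge /= enum_uniq /=.
  rewrite (_ : [set x in enum e]%SET = e) ?eH //.
  by apply/setP => x; rewrite inE mem_enum.
have Eperm := @ordered_edge_perm _ _ H.
have Euniq := @ordered_edge_uniq _ _ H.
have Esize := @ordered_edge_size _ _ H.
have Edeg t : size t = b.+1 -> uniq t -> (1 + g) / 2 * #|V|%:R <= deg R E t.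
  move=> st ut; apply: le_trans _ (min_degree_le_deg H R isT ut st).
  apply: le_trans Hdeg; rewrite ler_wpM2r //; lra.
have N0 : 0 < num_edges R b.+1 E := num_edges_gt0 R Esize Ex0.
have mix M x y : E x -> E y -> (m + b.+2 <= M)%N ->
    `|num_edges R b.+1 E * iter M (next_mean (tight_prob R b.+1 E)) (fun z => (z == x)%:R) y - 1|
      <= xi.
  move=> Ex Ey mM.
  have im : (b.+2 * (m %/ b.+2).+1 <= M)%N.
    by rewrite mulnS mulnC addnC (leq_trans _ mM) // leq_add2r leq_trunc_div.
  have := mixing Eperm Euniq Esize g0 g1 V0 Edeg Ex Ey im.
  rewrite ler_pdivlMr // -[X in _ * X](ger0_norm (ltW N0)) -normrM mulrBl mulVf ?gt_eqF //.
  by rewrite mulrC.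
have mix2 x y : E x -> E y -> (2 * num_edges R b.+1 E)^-1 <=
    iter (m + b.+2) (next_mean (tight_prob R b.+1 E)) (fun z => (z == x)%:R) y.
  move=> Ex Ey; have := mix _ x y Ex Ey (leqnn _).
  rewrite ler_norml => /andP[h _].
  rewrite -[leLHS]mulr1 ler_pdivrMl ?mulr_gt0 // -mulrA.
  suff : xi <= 1 / 2 by lra.
  have : xi <= K0 * xi * lK by rewrite -mulrA mulrCA ler_peMr // -[1]mulr1 ler_pM.
  have := xi_small; rewrite -!mulrA; lra.
have [||W [W0 Wedge Wa]] := @exists_walk_weights R V b E g m Eperm Euniq Esize g0 V0 Edeg
  mix2 x0 xi Ex0.
- by move=> y Ey; apply: mix => //; rewrite -lm.
- rewrite -lm -/K -/K0 -/lK.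
  have : 4 * K0 * lK ^+ 2 * collision_rate R V b m <= 1.
    by rewrite /collision_rate -lm mulrA ler_pdivrMr // mul1r.
  rewrite expr2; move: xi_small; lra.
apply: (@fractional_decomposition_of_walks R _ l V H W (b.+2)`!%:R) => //.
- by rewrite ltr0n fact_gt0.
- by rewrite lm.
- rewrite lm => v sv /(Wedge v sv)[uv vE]; split => // i.
  by have /andP[] := vE i.
by move=> s us sH; rewrite lm; apply: Wa; rewrite /E /ordered_edge us.
Qed.
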